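(* Let $1<q\le p<\infty$. Suppose that $f$ and $f_k$ $(k=1,2,\ldots)$ are nonnegative, $\|f_k\|_{\mathcal{B}^{p'}_{q'}(\mathbb{R}^n)}\le 1$ and $f_k\uparrow f$ a.e. Then $f\in\mathcal{B}^{p'}_{q'}(\mathbb{R}^n)$ and $\|f\|_{\mathcal{B}^{p'}_{q'}(\mathbb{R}^n)}\le 1$.
   Context: For $1<r<\infty$, $r'$ denotes the conjugate exponent, $1/r+1/r'=1$. $\mathcal{Q}$ is the family of all cubes in $\mathbb{R}^n$ with sides parallel to the coordinate axes, and $|Q|$ is the volume of $Q$. Let $1<q\le p<\infty$. A function $b$ on $\mathbb{R}^n$ is a $(p',q')$-block provided that $b$ is supported on a cube $Q\in\mathcal{Q}$ and satisfies $$\left(\int_Q |b(x)|^{q'}\,dx\right)^{1/q'}\le |Q|^{\frac1p-\frac1q}.$$ The block space $\mathcal{B}^{p'}_{q'}(\mathbb{R}^n)$ is the set of all functions $f$ locally in $L^{q'}(\mathbb{R}^n)$ with the norm $$\|f\|_{\mathcal{B}^{p'}_{q'}(\mathbb{R}^n)}:=\inf\left\{\|\{\lambda_k\}\|_{\ell^1}:\ f=\sum_k\lambda_k b_k\right\}<\infty,$$ where $\|\{\lambda_k\}_{k=1}^\infty\|_{\ell^1}=\sum_k|\lambda_k|<\infty$, each $b_k$ is a $(p',q')$-block, and the infimum is taken over all possible decompositions of $f$.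
   Formalization: In the definition of the block space, ''locally in L^{q'}'' is replaced by ''measurable'' (for f_k and f), since with it the claim that f lies in the block space fails when q<p: the limit f may have block norm at most 1 without being locally in L^{q'}. *)

(* Defs.v *)
From HB Require Import structures.
From mathcomp Require Import all_boot all_order all_algebra.
From mathcomp Require Import all_classical all_reals all_analysis.
From mathcomp Require Import measurable_realfun.

Set Implicit Arguments.
Unset Strict Implicit.
Unset Printing Implicit Defensive.

Import Order.TTheory GRing.Theory Num.Theory.
Import numFieldNormedType.Exports.

Local Open Scope classical_set_scope.
Local Open Scope ring_scope.
Local Open Scope ereal_scope.

Section tuple_cons.
Context {R : realType} {n : nat}.
Local Notation rT := (measurableTypeR R).

Definition tcons (z : rT * n.-tuple rT) : n.+1.-tuple rT :=
  [the n.+1.-tuple rT of z.1 :: z.2].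

Definition tuncons (x : n.+1.-tuple rT) : rT * n.-tuple rT :=
  (thead x, [tuple of behead x]).

Lemma tconsK : cancel tcons tuncons.
Proof.
move=> [a t]; rewrite /tuncons /tcons /=; congr pair.
by apply: val_inj.
Qed.

Lemma tunconsK : cancel tuncons tcons.
Proof. by move=> x; rewrite [RHS]tuple_eta; apply: val_inj. Qed.

Lemma measurable_tcons : measurable_fun setT tcons.
Proof. exact: measurable_cons. Qed.

Lemma measurable_tuncons : measurable_fun setT tuncons.
Proof.
apply: measurable_fun_pair; first exact: measurable_tnth.
exact: measurable_behead.
Qed.

End tuple_cons.

Section lebesgue_tupleS.
Context {R : realType} {n : nat}.
Local Notation rT := (measurableTypeR R).
Variable mu : {sigma_finite_measure set (n.-tuple rT) -> \bar R}.

Definition lebesgue_tupleS : set (n.+1.-tuple rT) -> \bar R :=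
  pushforward ((@lebesgue_measure R) \x mu) tcons.

Let lebesgue_tupleS0 : lebesgue_tupleS set0 = 0.
Proof. by rewrite /lebesgue_tupleS /pushforward preimage_set0 measure0. Qed.

Let lebesgue_tupleS_ge0 A : 0 <= lebesgue_tupleS A.
Proof. by rewrite /lebesgue_tupleS /pushforward; exact: measure_ge0. Qed.

Let lebesgue_tupleS_sigma_additive : semi_sigma_additive lebesgue_tupleS.
Proof.
move=> F mF tF mUF; rewrite /lebesgue_tupleS /pushforward preimage_bigcup.
apply: measure_semi_sigma_additive.
- by move=> k; rewrite -[X in measurable X]setTI; exact: measurable_tcons.
- apply/trivIsetP => /= i j _ _ ij; rewrite -preimage_setI.
  by move/trivIsetP : tF => /(_ _ _ _ _ ij) ->//; rewrite preimage_set0.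
- by rewrite -preimage_bigcup -[X in measurable X]setTI; exact: measurable_tcons.
Qed.

HB.instance Definition _ := isMeasure.Build _ _ _ lebesgue_tupleS
  lebesgue_tupleS0 lebesgue_tupleS_ge0 lebesgue_tupleS_sigma_additive.

Let lebesgue_tupleS_sigma_finite : sigma_finite setT lebesgue_tupleS.
Proof.
have [F FT mF] : sigma_finite setT ((@lebesgue_measure R) \x mu).
  have /sigma_finiteP[F [TF ndF Foo]] := sigma_finiteT (@lebesgue_measure R).
  have /sigma_finiteP[G [TG ndG Goo]] := sigma_finiteT mu.
  exists (fun k => F k `*` G k).
    rewrite -setXTT TF TG; apply/seteqP; split => -[x y].
      move=> [/= [i _ Fix] [j _ Gjy]]; exists (maxn i j) => //; split.
      - by move: x Fix; exact/subsetPset/ndF/leq_maxl.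
      - by move: y Gjy; exact/subsetPset/ndG/leq_maxr.
    by move=> [k _ []/= ? ?]; split; exists k.
  move=> k; have [? ?] := Foo k; have [? ?] := Goo k.
  split; first exact: measurableX.
  by rewrite product_measure1E// lte_mul_pinfty// ge0_fin_numE.
exists (fun k => tuncons @^-1` F k); first by rewrite -preimage_bigcup -FT.
move=> k; split.
  rewrite -[X in measurable X]setTI; apply: measurable_tuncons => //.
  exact: (mF k).1.
rewrite /lebesgue_tupleS /pushforward -comp_preimage.
rewrite (_ : tuncons \o tcons = id); first exact: (mF k).2.
by apply/funext => z /=; rewrite tconsK.
Qed.

HB.instance Definition _ := Measure_isSigmaFinite.Build _ _ _ lebesgue_tupleS
  lebesgue_tupleS_sigma_finite.

End lebesgue_tupleS.

(* n-fold product of the one-dimensional Lebesgue measure, on the Borel sets *)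
Fixpoint lebesgue_tuple (R : realType) (n : nat) :
    {sigma_finite_measure set (n.-tuple (measurableTypeR R)) -> \bar R} :=
  match n with
  | 0%N => \d_([tuple] : 0.-tuple (measurableTypeR R))
  | m.+1 => lebesgue_tupleS (lebesgue_tuple R m)
  end.

(* R^n with the sigma-algebra of Lebesgue (not merely Borel) measurable sets,
   obtained as the Caratheodory-measurable sets of the outer measure induced by
   [lebesgue_tuple R n]. *)
Notation Rn R n := (caratheodory_type ((lebesgue_tuple R n)^*)%mu).

Definition lebesgue_Rn (R : realType) (n : nat) :
    {measure set (Rn R n) -> \bar R} :=
  completed_measure_extension (mu := lebesgue_tuple R n).

Definition coord (R : realType) (n : nat) (x : Rn R n) (i : 'I_n) : R :=
  tnth (x : n.-tuple R) i.

Definition box (R : realType) (n : nat) (a b : 'I_n -> R) : set (Rn R n) :=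
  [set x | forall i, (a i <= coord x i <= b i)%R].

Definition is_cube (R : realType) (n : nat) (Q : set (Rn R n)) : Prop :=
  exists (a : 'I_n -> R) (l : R),
    (0 < l)%R /\ Q = box a (fun i => a i + l)%R.

Section box_volume.
Context {R : realType}.
Local Notation rT := (measurableTypeR R).

Lemma lebesgue_tuple_box n (a b : 'I_n -> R) : (forall i, a i <= b i)%R ->
  measurable (box a b : set (n.-tuple rT)) /\
  lebesgue_tuple R n (box a b) = (\prod_(i < n) (b i - a i))%R%:E.
Proof.
elim: n a b => [|n IHn] a b ab.
  rewrite big_ord0 (_ : box a b = setT); last first.
    by apply/seteqP; split => // x _ [].
  by split; [exact: measurableT|rewrite /= diracT].
have [mB muB] := IHn (a \o lift ord0) (b \o lift ord0) (fun i => ab _).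
have mI : measurable (`[a ord0, b ord0]%classic : set rT) by exact: measurable_itv.
have boxE : box a b = tuncons @^-1`
    (`[a ord0, b ord0]%classic `*` box (a \o lift ord0) (b \o lift ord0)).
  apply/seteqP; split => x /=.
    move=> xab; split => /=.
      by rewrite in_itv/=; have := xab ord0; rewrite /coord.
    move=> i; have := xab (lift ord0 i).
    by rewrite /coord /= [in X in X -> _](tuple_eta x) tnthS.
  move=> [] /=; rewrite in_itv/= => x0 xB i.
  have [->//|[j ->]] : i = ord0 \/ exists j, i = lift ord0 j.
    by case: (unliftP ord0 i) => [j ->|->]; [right; exists j|left].
  by have := xB j; rewrite /coord /= [in X in _ -> X](tuple_eta x) tnthS.
split.
  rewrite boxE -[X in measurable X]setTI; apply: measurable_tuncons => //.
  exact: measurableX.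
rewrite /= /lebesgue_tupleS /pushforward boxE -comp_preimage.
rewrite (_ : tuncons \o tcons = id); last first.
  by apply/funext => z /=; rewrite tconsK.
rewrite preimage_id product_measure1E// big_ord_recl/= EFinM; congr (_ * _) => //.
rewrite lebesgue_measure_itv/= lte_fin.
by have := ab ord0; rewrite le_eqVlt => /orP[/eqP->|->//]; rewrite ltxx subrr.
Qed.

Lemma measurable_box n (a b : 'I_n -> R) : (forall i, a i <= b i)%R ->
  measurable (box a b).
Proof.
by move=> /lebesgue_tuple_box[mB _]; exact: caratheodory_measurable_mu_ext.
Qed.

Lemma lebesgue_Rn_box n (a b : 'I_n -> R) : (forall i, a i <= b i)%R ->
  lebesgue_Rn R n (box a b) = (\prod_(i < n) (b i - a i))%R%:E.
Proof.
move=> /lebesgue_tuple_box[mB <-].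
by rewrite /lebesgue_Rn /= /completed_measure_extension measurable_mu_extE.
Qed.

End box_volume.

Definition conj_exp (R : realType) (r : R) : R := ((1 - r^-1)^-1)%R.

Section block_space.
Context {R : realType} {n : nat}.
Local Notation mu := (lebesgue_Rn R n).
Implicit Types (p q : R) (b : Rn R n -> R) (f : Rn R n -> \bar R).

Definition is_block p q b : Prop :=
  measurable_fun setT b /\
  exists Q : set (Rn R n),
    [/\ is_cube Q, (forall x, ~ Q x -> b x = 0%R) &
      (\int[mu]_(x in Q) ((`|b x| `^ conj_exp q)%R)%:E) `^ (conj_exp q)^-1
        <= mu Q `^ (p^-1 - q^-1)].

Definition block_decomposition p q f (lambda : nat -> R)
    (b : nat -> Rn R n -> R) : Prop :=
  [/\ \sum_(k <oo) (`|lambda k|%R)%:E < +oo,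
      (forall k, is_block p q (b k)) &
      {ae mu, forall x,
        ((\sum_(0 <= k < N) lambda k * b k x)%R)%:E @[N --> \oo] --> f x}].

(* [+oo] when [f] has no decomposition *)
Definition block_norm p q f : \bar R :=
  ereal_inf [set s | exists (lambda : nat -> R) (b : nat -> Rn R n -> R),
                       block_decomposition p q f lambda b /\
                       s = \sum_(k <oo) (`|lambda k|%R)%:E].

(* The ambient class is that of all measurable functions; requiring moreover
   that f be in L^{q'}_loc would destroy the Fatou property when q < p.  Take
   pairwise disjoint cubes Q_k (k >= 1) inside a bounded set with
   |Q_k| = 2 ^ (- k m), m >= (1/q - 1/p)^-1, and the blocks
   b_k = |Q_k| ^ (1/p - 1/q - 1/q') 1_{Q_k}.  The partial sums of
   f = sum_k 2 ^ (- k) b_k are in L^{q'} and have norm <= 1, but f is not in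
   L^{q'}_loc. *)
Definition block_space p q f : Prop :=
  measurable_fun setT f /\ block_norm p q f < +oo.

End block_space.

(* Main.v *)
Require Import Defs.
From mathcomp Require Import all_boot all_order all_algebra.
From mathcomp Require Import all_classical all_reals all_analysis.
From mathcomp Require Import measurable_realfun.
From mathcomp Require Import ring lra zify.

(** The theorem is a compactness statement, and the point is to get it with the
sharp constant [1].

The block space norm is a lattice norm: to bound the norm of a nonnegative [f]
it is enough to dominate [f] by a series of multiples of blocks, which can then
be trimmed to sum up to [f] exactly ([greedy_summands], [block_norm_le]).  So
let [s > 1], and let each [f_ k] be dominated by a series of multiples of blocks
whose coefficients add up to at most [s].

Suppose first [q < p].  Every cube is contained in a cube of a fixed countable
grid whose volume is larger by a factor at most [s ^ (2 n)]
([grid_cube_cover]).  Summing up, by Minkowski's inequality, the blocks that are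
assigned to the same grid cube, one gets for each [k] a domination of [f_ k] by
pieces [xi i], one for each grid cube [G i], such that the weighted sum of the
[L^q'] norms of the [xi i] is at most [s ^ (2 n + 1)]: an [admissible]
decomposition ([admissible_of_series]).  Admissible decompositions form a
convex set that decreases with [k].  The lemma [komlos] chooses one of them for
each [k] so that, for every [i], the [i]-th pieces converge almost everywhere,
and by Fatou the limits satisfy the same norm bound.  They dominate every [f_ k]
unless mass escapes in the index [i].  It does not: on a bounded set [B],
Hoelder's inequality bounds the integral of a piece living on [G] by its cost
times [|B & G|^(1/q) |G|^(1/p - 1/q)], which is small for large [G] because
[q < p], is small for small [G], and vanishes when [G] does not meet [B]
([grid_cube_tail_small]).  So the pieces beyond a finite set of grid cubes have
a total [L^1] norm on [B] that is small uniformly in [k] ([admissible_lim]).  Hence the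
norm of [f] is at most [s ^ (2 n + 1)], and [s] tends to [1].

If [q = p], the block space norm is the [L^q'] norm: Minkowski and Fatou bound
the [L^q'] norm of [f] by [1] ([Lnorm_le_of_block_norm]), and cutting [f] along
a rapidly growing sequence of cubes decomposes it at an arbitrarily small extra
cost ([Lnorm_cut]). *)

Import Order.TTheory GRing.Theory Num.Theory.
Import numFieldNormedType.Exports.

Set Implicit Arguments.
Unset Strict Implicit.
Unset Printing Implicit Defensive.

Local Open Scope classical_set_scope.
Local Open Scope ring_scope.
Local Open Scope ereal_scope.

(** * Lower limits and L^r norms *)

Lemma einfs_le_limn_einf (R : realType) (a : (\bar R)^nat) k :
  einfs a k <= limn_einf a.
Proof.
rewrite limn_einf_lim; apply: lime_ge; first exact: is_cvg_einfs.
by near=> m; apply: nondecreasing_einfs; near: m; exists k.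
Unshelve. all: by end_near. Qed.

Lemma limn_einf_le (R : realType) (a : (\bar R)^nat) z :
  (forall k, einfs a k <= z) -> limn_einf a <= z.
Proof.
move=> az; rewrite limn_einf_lim; apply: lime_le; first exact: is_cvg_einfs.
exact: nearW.
Qed.

Lemma limn_einf_le_ub (R : realType) (a : (\bar R)^nat) c :
  (forall k, a k <= c) -> limn_einf a <= c.
Proof.
move=> ac; apply: limn_einf_le => k; apply: le_trans (ac k).
by apply: ereal_inf_lbound; exists k => /=.
Qed.

Lemma limn_einf_ge0 (R : realType) (a : (\bar R)^nat) :
  (forall k, 0 <= a k) -> 0 <= limn_einf a.
Proof.
move=> a0; apply: le_trans (einfs_le_limn_einf a 0%N).
by apply: le_ereal_inf_tmp => _ [m _ <-].
Qed.

Lemma le_limn_einf (R : realType) (a b : (\bar R)^nat) :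
  (forall k, a k <= b k) -> limn_einf a <= limn_einf b.
Proof.
move=> ab; apply: limn_einf_le => k; apply: le_trans (einfs_le_limn_einf b k).
apply: le_ereal_inf_tmp => _ [m /= km <-]; apply: le_trans (ab m).
by apply: ereal_inf_lbound; exists m.
Qed.

Lemma le_poweR (R : realType) (x y : \bar R) (r : R) : (0 <= r)%R -> 0 <= x ->
  x <= y -> x `^ r <= y `^ r.
Proof.
move=> r0 x0 xy; apply: gt0_ler_poweR => //; rewrite in_itv/= leey andbT//.
exact: le_trans xy.
Qed.

(** Since [x `^ r] and its inverse [x `^ r^-1] are both monotone, a lower bound
of the tail of [a] is the same thing as a lower bound of the tail of its
powers. *)
Lemma poweR_limn_einf_le (R : realType) (a : (\bar R)^nat) (r : R) :
  (0 < r)%R -> (forall k, 0 <= a k) ->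
  (limn_einf a) `^ r <= limn_einf (fun k => a k `^ r).
Proof.
move=> r0 a0; set z := limn_einf (fun k => a k `^ r).
have z0 : 0 <= z by apply: limn_einf_ge0 => k; exact: poweR_ge0.
have -> : z = (z `^ r^-1) `^ r by rewrite -poweRrM mulVf ?gt_eqF// poweRe1.
apply: le_poweR; [exact: ltW|exact: limn_einf_ge0|].
apply: limn_einf_le => k.
have e0 : 0 <= einfs a k by apply: le_ereal_inf_tmp => _ [m _ <-].
have -> : einfs a k = (einfs a k `^ r) `^ r^-1.
  by rewrite -poweRrM mulfV ?gt_eqF// poweRe1.
apply: le_poweR; [by rewrite invr_ge0 ltW|exact: poweR_ge0|].
apply: le_trans (einfs_le_limn_einf _ k).
apply: le_ereal_inf_tmp => _ [m /= km <-]; apply: le_poweR => //; first exact: ltW.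
by apply: ereal_inf_lbound; exists m.
Qed.

(** Fatou's lemma for the counting measure. *)
Lemma nneseries_limn_einf (R : realType) (a : nat -> nat -> \bar R) :
  (forall s i, 0 <= a s i) ->
  \sum_(i <oo) limn_einf (a ^~ i) <= limn_einf (fun s => \sum_(i <oo) a s i).
Proof.
move=> a0; rewrite -ge0_integral_count; last by move=> i; exact: limn_einf_ge0.
have -> : (fun s => \sum_(i <oo) a s i) = (fun s => \int[counting]_i a s i).
  by apply/funext => s; rewrite ge0_integral_count.
exact: fatou.
Qed.

Lemma measurable_limn_einf d (T : measurableType d) (R : realType)
  (f : nat -> T -> \bar R) : (forall s, measurable_fun setT (f s)) ->
  measurable_fun setT (fun x => limn_einf (f ^~ x)).
Proof.
move=> mf; rewrite /limn_einf; apply: measurableT_comp => //.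
apply: (measurable_fun_limn_esup (f := fun s x => - f s x)) => s.
exact: measurableT_comp.
Qed.

Lemma measurable_nneseries d (T : measurableType d) (R : realType) (D : set T)
  (h : nat -> T -> \bar R) : (forall i x, D x -> 0 <= h i x) ->
  (forall i, measurable_fun D (h i)) ->
  measurable_fun D (fun x => \sum_(i <oo) h i x).
Proof.
move=> h0 mh; apply: (@ge0_emeasurable_sum _ _ _ D h xpredT) => // k x Dx _.
exact: h0.
Qed.

Section Lnorm_lattice.
Context d (T : measurableType d) (R : realType) (mu : {measure set T -> \bar R}).
Context (r : R) (r1 : (1 <= r)%R).
Local Notation "'N_[ f ]" := (Lnorm mu r%:E f) (format "''N_[' f ]").

Let r0 : (0 < r)%R. Proof. exact: lt_le_trans r1. Qed.

Lemma measurable_abse_poweR (f : T -> \bar R) : measurable_fun setT f ->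
  measurable_fun setT (fun x => `|f x| `^ r).
Proof.
move=> mf; apply: (@measurableT_comp _ _ _ _ _ _ (fun x => x `^ r)) => //=.
  exact: measurable_poweR.
exact: measurableT_comp.
Qed.

Lemma le_Lnorm (f g : T -> \bar R) : measurable_fun setT f ->
  measurable_fun setT g -> {ae mu, forall x, `|f x| <= `|g x|} ->
  'N_[f] <= 'N_[g].
Proof.
move=> mf mg fg; rewrite unlock; apply: le_poweR.
- by rewrite invr_ge0 ltW.
- by apply: integral_ge0 => x _; exact: poweR_ge0.
apply: ae_ge0_le_integral => //.
- by move=> x _; exact: poweR_ge0.
- exact: measurable_abse_poweR.
- by move=> x _; exact: poweR_ge0.
- exact: measurable_abse_poweR.
by apply: filterS fg => x fgx _; apply: le_poweR => //; exact: ltW.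
Qed.

Lemma le_Lnorm_EFin (u v : T -> R) : measurable_fun setT u ->
  measurable_fun setT v -> (forall x, 0 <= v x <= u x)%R ->
  'N_[EFin \o v] <= 'N_[EFin \o u].
Proof.
move=> mu_ mv vu; apply: le_Lnorm; [exact/measurable_EFinP|exact/measurable_EFinP|].
apply: aeW => x /=; rewrite lee_fin; case/andP: (vu x) => v0 vux.
by rewrite !ger0_norm// (le_trans v0).
Qed.

(** Fatou's lemma for the integral of the [r]-th powers, with
[poweR_limn_einf_le] applied to the exponents [r] (inside the integral) and
[r^-1] (outside). *)
Lemma Lnorm_fatou (u : nat -> T -> \bar R) :
  (forall s, measurable_fun setT (u s)) -> (forall s x, 0 <= u s x) ->
  'N_[fun x => limn_einf (u ^~ x)] <= limn_einf (fun s => 'N_[u s]).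
Proof.
move=> mu_ u0.
have LE f : 'N_[f] = (\int[mu]_x (`|f x| `^ r)) `^ r^-1 by rewrite unlock.
rewrite LE (_ : (fun s => 'N_[u s]) =
  fun s => (\int[mu]_x (`|u s x| `^ r)) `^ r^-1); last by apply/funext.
apply: (@le_trans _ _ ((limn_einf (fun s => \int[mu]_x (`|u s x| `^ r))) `^ r^-1)).
  apply: le_poweR; first by rewrite invr_ge0 ltW.
    by apply: integral_ge0 => x _; exact: poweR_ge0.
  apply: (@le_trans _ _ (\int[mu]_x limn_einf (fun s => `|u s x| `^ r))).
    apply: ge0_le_integral => //.
    - by move=> x _; exact: poweR_ge0.
    - by apply: measurable_abse_poweR; exact: measurable_limn_einf.
    - apply: (measurable_limn_einf (f := fun s x => `|u s x| `^ r)) => k.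
      exact: measurable_abse_poweR.
    move=> x _; rewrite gee0_abs; last exact: limn_einf_ge0.
    apply: le_trans (poweR_limn_einf_le r0 _) _ => //.
    by apply: le_limn_einf => k; rewrite gee0_abs.
  apply: fatou => // k; first exact: measurable_abse_poweR.
  by move=> x _; exact: poweR_ge0.
apply: poweR_limn_einf_le; first by rewrite invr_gt0.
by move=> k; apply: integral_ge0 => x _; exact: poweR_ge0.
Qed.

Lemma Lnorm_sum (u : nat -> T -> R) N :
  (forall i, measurable_fun setT (u i)) ->
  'N_[fun x => (\sum_(0 <= i < N) u i x)%:E] <= \sum_(0 <= i < N) 'N_[EFin \o u i].
Proof.
move=> mu_; elim: N => [|N IH].
  rewrite big_geq// (_ : (fun x => _) = cst 0) ?Lnorm0 ?gt_eqF//.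
  by apply/funext => x; rewrite big_geq.
rewrite big_nat_recr//=.
have -> : (fun x => (\sum_(0 <= i < N.+1) u i x)%:E) =
   EFin \o ((fun x => (\sum_(0 <= i < N) u i x)%R) \+ u N)%R.
  by apply/funext => x /=; rewrite big_nat_recr.
apply: le_trans (minkowski_EFin mu _ _ r1) _ => //.
  by apply: measurable_sum.
by rewrite leeD2r.
Qed.

Lemma cvg_limn_einfE (a : (\bar R)^nat) l : a @ \oo --> l -> limn_einf a = l.
Proof.
by move=> al; rewrite limn_einf_lim; apply/cvg_lim => //; exact: cvg_einfs.
Qed.

(** Minkowski's inequality holds for the partial sums, and the norm of their
limit is controlled by Fatou. *)
Lemma Lnorm_nneseries (u : nat -> T -> R) :
  (forall i, measurable_fun setT (u i)) -> (forall i x, 0 <= u i x)%R ->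
  'N_[fun x => \sum_(i <oo) (u i x)%:E] <= \sum_(i <oo) 'N_[EFin \o u i].
Proof.
move=> mu_ u0; set S := fun N x => (\sum_(0 <= i < N) u i x)%:E.
have -> : (fun x => \sum_(i <oo) (u i x)%:E) = (fun x => limn_einf (S ^~ x)).
  apply/funext => x; apply/esym/cvg_limn_einfE.
  rewrite (_ : S ^~ x = fun N => \sum_(0 <= i < N) (u i x)%:E).
    by apply: is_cvg_nneseries => i _ _; rewrite lee_fin.
  by apply/funext => N; rewrite /S sumEFin.
apply: le_trans (Lnorm_fatou _ _) _.
- by move=> N; apply/measurable_EFinP; exact: measurable_sum.
- by move=> N x; rewrite lee_fin sumr_ge0.
apply: limn_einf_le_ub => N; apply: le_trans (Lnorm_sum N mu_) _.
by apply: nneseries_lim_ge => i _ _; exact: Lnorm_ge0.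
Qed.

Lemma LnormZ_ge0 (c : R) (u : T -> R) : (0 <= c)%R -> measurable_fun setT u ->
  'N_[fun x => (c * u x)%:E] = c%:E * 'N_[EFin \o u].
Proof.
move=> c0 mu_; rewrite unlock.
under eq_integral do rewrite EFinM abseM poweRM// (gee0_abs (x := c%:E))//.
rewrite ge0_integralZl//.
- rewrite poweRM ?poweR_ge0 ?integral_ge0// => [|x _]; last exact: poweR_ge0.
  by rewrite -poweRrM mulfV ?gt_eqF// poweRe1.
- by apply: measurable_abse_poweR; exact/measurable_EFinP.
- by move=> x _; exact: poweR_ge0.
- exact: poweR_ge0.
Qed.

Lemma Lnorm_lty_ae (f : T -> \bar R) : measurable_fun setT f ->
  'N_[f] < +oo -> {ae mu, forall x, f x \is a fin_num}.
Proof.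
move=> mf; rewrite unlock => /lty_poweRy; rewrite invr_eq0 gt_eqF// => /(_ isT) If.
have : mu.-integrable setT (fun x => `|f x| `^ r).
  apply/integrableP; split; first exact: measurable_abse_poweR.
  by under eq_integral do rewrite gee0_abs ?poweR_ge0//.
move=> /(integrable_ae measurableT); apply: filterS => x /(_ I).
case: (f x) => //=; rewrite gt_eqF//.
Qed.

End Lnorm_lattice.

(** * Almost everywhere convergence of near-minimizers *)

(** [I] is the supremum over [k] of the infima of [psi] on [P k].  Because the
sets decrease, arbitrarily far sets [P K] contain points where [psi] is at most
[I + e], while [psi] exceeds [I - e] on all of [P K]: near-minimizers exist and
cannot be improved. *)
Lemma sup_inf_decreasing (R : realType) (X : Type) (P : nat -> set X)
    (psi : X -> R) (M : R) :
  (forall k m, (k <= m)%N -> P m `<=` P k) -> (forall k, P k !=set0) ->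
  (forall x, 0 <= psi x <= M)%R ->
  exists I : R, forall s (e : R), (0 < e)%R -> exists K, [/\ (s <= K)%N,
    (forall x, P K x -> I - e < psi x)%R & exists2 x, P K x & (psi x < I + e)%R].
Proof.
move=> Pdec P0 psiM.
have lbP k : has_inf (psi @` P k).
  split; first by have [x Px] := P0 k; exists (psi x), x.
  by exists 0%R => _ [x _ <-]; case/andP: (psiM x).
have supP : has_sup (range (fun k => inf (psi @` P k))).
  split; first by exists (inf (psi @` P 0%N)), 0%N.
  exists M => _ [k _ <-]; have [x Px] := P0 k.
  apply: le_trans (_ : psi x <= M)%R; last by case/andP: (psiM x).
  by apply: ge_inf; [exact: (lbP k).2|exists x].
exists (sup (range (fun k => inf (psi @` P k)))) => s e e0.
have [_ [k _ <-] Ik] := sup_adherent e0 supP.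
exists (maxn s k); split; first exact: leq_maxl.
- move=> x Px; apply: (lt_le_trans Ik); apply: ge_inf; first exact: (lbP k).2.
  by exists x => //; apply: Pdec Px; exact: leq_maxr.
- have [_ [x Px <-] xI] := inf_adherent e0 (lbP (maxn s k)).
  exists x => //; apply: (lt_le_trans xI); rewrite lerD2r.
  by apply: ub_le_sup; [exact: supP.2|exists (maxn s k)].
Qed.

(** From [2 * `|a| <= 2 ^- s + 2 ^+ s * a ^+ 2] the increments of [u] are
absolutely summable. *)
Lemma cvg_of_weighted_square (R : realType) (u : nat -> R) :
  \sum_(s <oo) (2 ^+ s * (u s - u s.+1) ^+ 2)%:E < +oo -> cvgn u.
Proof.
move=> uoo.
suff : cvgn (series (telescope u)).
  rewrite telescopeK => cu.
  have -> : u = (fun n => (u n - u 0%N) + u 0%N)%R.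
    by apply/funext => n; rewrite subrK.
  by apply: is_cvgD => //; exact: is_cvg_cst.
apply: normed_cvg; apply: nnseries_is_cvg => [i|]; first exact: normr_ge0.
apply: (@le_lt_trans _ _ (\sum_(s <oo) ((2 / (2 ^ s.+1)%:R)%:E +
                          (2 ^+ s * (u s - u s.+1) ^+ 2)%:E))).
  apply: lee_nneseries => [i _ _|s _]; first by rewrite lee_fin normr_ge0.
  rewrite -EFinD lee_fin.
  rewrite /telescope natrX exprS.
  rewrite -[(u s - u s.+1)%R]opprB sqrrN.
  set a := (u s.+1 - u s)%R; set b := (2 ^+ s)%R.
  have b0 : (0 < b)%R by rewrite exprn_gt0.
  rewrite invfM mulrA divff ?mul1r//.
  rewrite -(ler_pM2r b0) mulrDl mulVf ?gt_eqF//.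
  have -> : (b * a ^+ 2 * b = (`|a| * b) ^+ 2)%R.
    by rewrite exprMn real_normK ?num_real//; ring.
  set y := (`|a| * b)%R; have := sqr_ge0 (y - 1)%R; have := sqr_ge0 y.
  by rewrite !expr2; nra.
rewrite nneseriesD => [|s _ _|s _ _]; last 2 first.
- by rewrite lee_fin divr_ge0.
- by rewrite lee_fin mulr_ge0 ?sqr_ge0// exprn_ge0.
apply: lte_add_pinfty => //.
by apply: le_lt_trans (ltry 2%R); exact: (epsilon_trick0 xpredT).
Qed.

(** The limit is taken in the extended reals: it is [+oo] when the exponentials
tend to [0]. *)
Lemma cvg_of_expR_half (R : realType) (x : nat -> R) :
  cvgn (fun s => expR (- x s / 2)) -> cvgn (fun s => (x s)%:E).
Proof.
move=> /cvg_ex[/= l xl].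
have l0 : (0 <= l)%R.
  rewrite -(cvg_lim _ xl)//; apply: limr_ge; first by apply/cvg_ex; exists l.
  by apply: nearW => s; exact: expR_ge0.
have [{}l0|] := ltP 0%R l; last first.
  move=> l0'; have {l0 l0'} l0 : l = 0%R by apply/eqP; rewrite eq_le l0'.
  apply/cvg_ex; exists +oo; apply/cvgeryP/cvgryPge => A.
  rewrite l0 in xl; have [N _ NP] := (cvgr_lt _ xl) _ (expR_gt0 (- A / 2)).
  exists N => // s Ns /=; have := NP s Ns; rewrite /= ltr_expR; lra.
apply/cvg_ex; exists (-2 * ln l)%:E; apply: cvg_EFin; first exact: nearW.
have -> : fine \o (fun s => (x s)%:E) = (fun s => -2 * ln (expR (- x s / 2)))%R.
  by apply/funext => s /=; rewrite expRK; field.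
apply: cvgM; first exact: cvg_cst.
by apply: continuous_cvg => //; exact: continuous_ln.
Qed.

Section komlos.
Context d (T : measurableType d) (R : realType) (mu : {measure set T -> \bar R}).
Variables (G : nat -> set T) (P : nat -> set (nat -> T -> R)).
Hypothesis mG : forall i, measurable (G i).
Hypothesis finG : forall i, mu (G i) < +oo.
Hypothesis Pdec : forall k m, (k <= m)%N -> P m `<=` P k.
Hypothesis P0 : forall k, P k !=set0.
Hypothesis Pm : forall k xi i, P k xi -> measurable_fun setT (xi i).
Hypothesis Pge0 : forall k xi i x, P k xi -> (0 <= xi i x)%R.
Hypothesis Pmid : forall k xi zeta, P k xi -> P k zeta ->
  P k (fun i x => (xi i x + zeta i x) / 2)%R.

(* These weights give phi the upper bound 1, whatever the measures of the sets
   G i. *)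
Let c (i : nat) : R := (1 / (2 ^ i.+1)%:R / (1 + fine (mu (G i))))%R.

Let c_gt0 i : (0 < c i)%R.
Proof.
by rewrite divr_gt0 ?divr_gt0 ?ltr0n ?expn_gt0// ltr_pwDl// fine_ge0.
Qed.

Let c_mu i : (c i)%:E * mu (G i) <= (1 / (2 ^ i.+1)%:R)%:E.
Proof.
have f0 : (0 <= fine (mu (G i)))%R by rewrite fine_ge0.
have -> : mu (G i) = (fine (mu (G i)))%:E by rewrite fineK// ge0_fin_numE.
rewrite -EFinM lee_fin /c -[leLHS]mulrA; apply: ler_piMr; first by rewrite divr_ge0.
by rewrite mulrC ler_pdivrMr ?ltr_pwDl// mul1r lerDr.
Qed.

Let phi (xi : nat -> T -> R) :=
  \sum_(i <oo) (c i)%:E * \int[mu]_(x in G i) (expR (- xi i x))%:E.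

(* The defect of convexity of phi at the midpoint, see phi_mid. *)
Let D (xi zeta : nat -> T -> R) := \sum_(i <oo) (c i)%:E *
  \int[mu]_(x in G i) ((expR (- xi i x / 2) - expR (- zeta i x / 2)) ^+ 2)%:E.

Let int_expR_ge0 (xi : nat -> T -> R) i :
  0 <= (c i)%:E * \int[mu]_(x in G i) (expR (- xi i x))%:E.
Proof.
apply: mule_ge0; first by rewrite lee_fin ltW.
by apply: integral_ge0 => x _; rewrite lee_fin expR_ge0.
Qed.

Let int_sqr_ge0 (xi zeta : nat -> T -> R) i : 0 <= (c i)%:E *
  \int[mu]_(x in G i) ((expR (- xi i x / 2) - expR (- zeta i x / 2)) ^+ 2)%:E.
Proof.
apply: mule_ge0; first by rewrite lee_fin ltW.
by apply: integral_ge0 => x _; rewrite lee_fin sqr_ge0.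
Qed.

Let phi_ge0 xi : 0 <= phi xi.
Proof. by apply: nneseries_ge0 => i _ _; exact: int_expR_ge0. Qed.

Let measurable_expRN (f : T -> R) (a : R) A : measurable_fun setT f ->
  measurable_fun A (fun x => expR (- f x / a)).
Proof.
move=> mf; apply: measurable_funTS; apply: measurableT_comp => //.
by apply: measurable_funM => //; exact: measurableT_comp.
Qed.

Let phi_le1 k xi : P k xi -> phi xi <= 1.
Proof.
move=> Pxi; apply: le_trans (epsilon_trick0 xpredT ler01).
apply: lee_nneseries => // i _; apply: le_trans (c_mu i).
apply: lee_wpmul2l; first by rewrite lee_fin ltW.
rewrite -[leRHS]mul1e -integral_cst//.
apply: ge0_le_integral => //.
- apply/measurable_EFinP; under eq_fun do rewrite -[X in expR X]divr1.
  by apply: measurable_expRN; exact: Pm Pxi.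
by move=> x _; rewrite lee_fin -expR0 ler_expR oppr_le0; exact: Pge0 Pxi.
Qed.

Let phi_mid k xi zeta : P k xi -> P k zeta ->
  phi xi + phi zeta = phi (fun i x => (xi i x + zeta i x) / 2)%R +
    phi (fun i x => (xi i x + zeta i x) / 2)%R + D xi zeta.
Proof.
move=> Pxi Pzeta; rewrite /phi /D.
have pm0 := int_expR_ge0 (fun i x => (xi i x + zeta i x) / 2)%R.
have add (f g : nat -> \bar R) : (forall i, 0 <= f i) -> (forall i, 0 <= g i) ->
    \sum_(i <oo) f i + \sum_(i <oo) g i = \sum_(i <oo) (f i + g i).
  by move=> f0 g0; rewrite nneseriesD.
have A1 := add _ _ (int_expR_ge0 xi) (int_expR_ge0 zeta).
have A2 := add _ _ pm0 pm0.
have A3 := add _ _ (fun i => adde_ge0 (pm0 i) (pm0 i)) (int_sqr_ge0 xi zeta).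
rewrite [LHS]A1 [X in _ = X + _]A2 [RHS]A3.
apply: eq_eseriesr => i _.
have mx := Pm i Pxi; have mz := Pm i Pzeta.
have mm : measurable_fun setT (fun x => (xi i x + zeta i x) / 2)%R.
  by apply: measurable_funM => //; exact: measurable_funD.
have m1 (f : T -> R) : measurable_fun setT f ->
    measurable_fun (G i) (fun x => (expR (- f x))%:E).
  move=> mf; apply/measurable_EFinP.
  by under eq_fun do rewrite -[X in expR X]divr1; exact: measurable_expRN.
have md : measurable_fun (G i)
    (fun x => ((expR (- xi i x / 2) - expR (- zeta i x / 2)) ^+ 2)%:E).
  apply/measurable_EFinP/measurable_funX.
  by apply: measurable_funB; exact: measurable_expRN.
have I0 (f : T -> R) : 0 <= \int[mu]_(x in G i) (expR (f x))%:E.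
  by apply: integral_ge0 => x _; rewrite lee_fin expR_ge0.
have Id0 : 0 <= \int[mu]_(x in G i)
    ((expR (- xi i x / 2) - expR (- zeta i x / 2)) ^+ 2)%:E.
  by apply: integral_ge0 => x _; rewrite lee_fin sqr_ge0.
have Im0 := adde_ge0 (I0 (fun x => - ((xi i x + zeta i x) / 2))%R)
  (I0 (fun x => - ((xi i x + zeta i x) / 2))%R).
rewrite -(ge0_muleDr _ (I0 _) (I0 _)) -(ge0_muleDr _ (I0 _) (I0 _)).
rewrite -(ge0_muleDr _ Im0 Id0).
congr (_ * _).
have e0 (f : T -> R) x : G i x -> 0 <= (expR (f x))%:E.
  by rewrite lee_fin expR_ge0.
rewrite -(ge0_integralD mu (mG i))//; [|exact: m1|exact: m1].
rewrite -(ge0_integralD mu (mG i))//; [|exact: m1|exact: m1].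
rewrite -(ge0_integralD mu (mG i))//; last 3 first.
- by move=> x Gx; rewrite adde_ge0.
- by apply: emeasurable_funD; exact: m1.
- by move=> x _; rewrite lee_fin sqr_ge0.
apply: eq_integral => x _; rewrite -!EFinD; congr _%:E.
have E a b : expR (- ((a + b) / 2)) = (expR (- a / 2) * expR (- b / 2))%R :> R.
  by rewrite -expRD; congr expR; field.
have E2 a : expR (- a) = (expR (- a / 2) ^+ 2)%R :> R.
  by rewrite expr2 -expRD; congr expR; field.
by rewrite E !E2; ring.
Qed.

(** The sets [P k] are decreasing, nonempty and closed under midpoints, so
weighted integrals of [expR (- xi)] behave on them like a strictly convex
bounded function.  Near-minimizers of it are close to each other, by the
identity

  exp(-a) + exp(-b) - 2 exp(-(a+b)/2) = (exp(-a/2) - exp(-b/2))^2,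

and choosing them with geometric precision yields almost everywhere
convergence, to a possibly infinite limit.  This is the argument behind
Komlos-type lemmas on forward convex combinations; the sum over [i] in the
functional [phi] makes it work for all components [xi i] simultaneously. *)
Lemma komlos : exists eta : nat -> nat -> T -> R, (forall s, P s (eta s)) /\
  forall i, {ae mu, forall x, G i x -> cvgn (fun s => (eta s i x)%:E)}.
Proof.
(* A real-valued function that agrees with phi on the sets P k; the truncation
   at 1 only matters outside of them. *)
have [psi psiM phiE] : exists2 psi : (nat -> T -> R) -> R,
    (forall xi, 0 <= psi xi <= 1)%R & forall k xi, P k xi -> phi xi = (psi xi)%:E.
  exists (fun xi => Num.min (fine (phi xi)) 1%R) => [xi|k xi Pxi].
    by rewrite le_min fine_ge0 ?phi_ge0// ler01 ge_min lexx orbT.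
  have le1 := phi_le1 Pxi.
  have fin : phi xi \is a fin_num by rewrite ge0_fin_numE// (le_lt_trans le1)// ltry.
  by rewrite min_l ?fineK// -lee_fin fineK.
have [I IP] := sup_inf_decreasing Pdec P0 psiM.
have e0 s : (0 < 4^-1 ^+ s.+1 :> R)%R by rewrite exprn_gt0.
have {IP} /choice[Keta KP] : forall s, exists Kx : nat * (nat -> T -> R),
    [/\ (s <= Kx.1)%N, P Kx.1 Kx.2,
      (forall x, P Kx.1 x -> I - 4^-1 ^+ s.+1 < psi x)%R &
      (psi Kx.2 < I + 4^-1 ^+ s.+1)%R].
  by move=> s; have [K [sK K1 [xi K2 K3]]] := IP s _ (e0 s); exists (K, xi).
pose eta s := (Keta s).2; exists eta.
split=> [s|i]; first by have [sK PK _ _] := KP s; exact: Pdec sK _ PK.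
have Peta s : P (Keta s).1 (eta s) by case: (KP s).
have Dle s : D (eta s) (eta s.+1) <= (4^-1 ^+ s)%:E.
  have [_ P1 lb1 ub1] := KP s; have [_ P2 lb2 ub2] := KP s.+1.
  (* Two consecutive near-minimizers lie together in the larger of their two
     sets, hence so does their midpoint, where phi is almost at least I. *)
  have [k [P1k P2k lbk]] : exists k, [/\ P k (eta s), P k (eta s.+1) &
      (forall x, P k x -> I - 4^-1 ^+ s.+1 < psi x)%R].
    have [K12|/ltnW K21] := leqP (Keta s).1 (Keta s.+1).1.
      by exists (Keta s).1; split => //; exact: Pdec K12 _ P2.
    exists (Keta s.+1).1; split => // [|x Px]; first exact: Pdec K21 _ P1.
    apply: le_lt_trans (lb2 _ Px); rewrite lerD2l lerN2 exprS ler_piMl ?ltW//.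
    by rewrite invf_lt1// ltr1n.
  have := phi_mid P1k P2k; have Pm12 := Pmid P1k P2k; have := lbk _ Pm12.
  rewrite (phiE _ _ P1) (phiE _ _ P2) (phiE _ _ Pm12).
  move: ub1 ub2; rewrite -/(eta s) -/(eta s.+1).
  move: (psi _) (psi _) (psi _) => a b m ua ub lm.
  case: (D _ _) => [r| |]//; rewrite -!EFinD => -[E].
  rewrite lee_fin; move: ua ub lm E; rewrite !exprS; have := e0 s; rewrite exprS.
  by set q := (4^-1 ^+ s)%R; lra.
pose g s x := (2 ^+ s * (expR (- eta s i x / 2) - expR (- eta s.+1 i x / 2)) ^+ 2)%R.
have mg s : measurable_fun (G i) (EFin \o g s).
  apply/measurable_EFinP; apply: measurable_funM => //; apply: measurable_funX.
  by apply: measurable_funB; apply: measurable_expRN; exact: (Pm i (Peta _)).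
have g0 s x : 0 <= (g s x)%:E by rewrite lee_fin mulr_ge0 ?sqr_ge0// exprn_ge0.
have Ig s : \int[mu]_(x in G i) (g s x)%:E <= ((c i)^-1 * 2 / (2 ^ s.+1)%:R)%:E.
  under eq_integral do rewrite EFinM.
  rewrite ge0_integralZl_EFin//; last 2 first.
  - by move=> x _; rewrite lee_fin sqr_ge0.
  - apply/measurable_EFinP; apply: measurable_funX.
    by apply: measurable_funB; apply: measurable_expRN; exact: (Pm i (Peta _)).
  set J := integral _ _ _.
  have J0 : 0 <= J by apply: integral_ge0 => x _; rewrite lee_fin sqr_ge0.
  have : (c i)%:E * J <= (4^-1 ^+ s)%:E.
    apply: le_trans (Dle s).
    rewrite /D (nneseriesD1 (n := i))//.
    by apply: leeDl; apply: nneseries_ge0 => j _ _; exact: int_sqr_ge0.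
  move: J0; case: J => [r| |]//; last by rewrite gt0_muley ?lte_fin// leye_eq.
  rewrite -!EFinM !lee_fin => r0 cr.
  have -> : ((c i)^-1 * 2 / (2 ^ s.+1)%:R = 2 ^+ s * ((c i)^-1 * 4^-1 ^+ s))%R.
    have -> : (4^-1 ^+ s = (2 ^+ s)^-1 * (2 ^+ s)^-1 :> R)%R.
      by rewrite -invfM -exprMn exprVn; congr ((_ ^+ _)^-1)%R; ring.
    by rewrite natrX exprS; field; rewrite !gt_eqF ?exprn_gt0.
  rewrite ler_pM2l ?exprn_gt0// -(ler_pM2l (c_gt0 i)) mulrA mulfV ?gt_eqF//.
  by rewrite mul1r.
have : mu.-integrable (G i) (fun x => \sum_(s <oo) (g s x)%:E).
  apply/integrableP; split.
    by apply: measurable_nneseries => // s x _; exact: g0.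
  under eq_integral do rewrite gee0_abs ?nneseries_ge0//.
  rewrite integral_nneseries//.
  apply: le_lt_trans (_ : ((c i)^-1 * 2)%:E < _); last exact: ltry.
  apply: le_trans (epsilon_trick0 xpredT _).
    by apply: lee_nneseries => [s _ _|s _]; [exact: integral_ge0|exact: Ig].
  by rewrite mulr_ge0// invr_ge0 ltW.
move=> /(integrable_ae (mG i)); apply: filterS => x + Gx => /(_ Gx) gfin.
apply: cvg_of_expR_half; apply: cvg_of_weighted_square.
by rewrite ltey_eq gfin.
Qed.
End komlos.

(** * Compactness of admissible decompositions *)

Lemma le_limn_einf_near (R : realType) (a : (\bar R)^nat) z K :
  (forall s, (K <= s)%N -> z <= a s) -> z <= limn_einf a.
Proof.
move=> za; apply: le_trans (einfs_le_limn_einf a K).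
by apply: le_ereal_inf_tmp => _ [m /= Km <-]; exact: za.
Qed.

Lemma limn_einf_le_inf_often (R : realType) (a : (\bar R)^nat) z :
  (forall K, exists2 s, (K <= s)%N & a s <= z) -> limn_einf a <= z.
Proof.
move=> az; apply: limn_einf_le => K; have [s Ks asz] := az K.
by apply: le_trans asz; apply: ereal_inf_lbound; exists s.
Qed.

Lemma mule_limn_einf_le (R : realType) (a : (\bar R)^nat) (c : R) : (0 <= c)%R ->
  (forall k, 0 <= a k) -> c%:E * limn_einf a <= limn_einf (fun k => c%:E * a k).
Proof.
rewrite le_eqVlt => /predU1P[<-|c0] a0.
  by rewrite mul0e; apply: limn_einf_ge0 => k; rewrite mul0e.
rewrite -lee_pdivlMl//; apply: limn_einf_le => k; rewrite lee_pdivlMl//.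
apply: le_trans (einfs_le_limn_einf _ k).
apply: le_ereal_inf_tmp => _ [m /= km <-]; rewrite lee_pmul2l//.
by apply: ereal_inf_lbound; exists m.
Qed.

(** A lower limit of sums can be split in this direction only when one of the
summands converges; this is where the almost everywhere convergence of
[komlos] is used. *)
Lemma le_add_of_limn_einf (R : realType) (x a : \bar R) (a_ b_ : (\bar R)^nat) K :
  a \is a fin_num -> a_ @ \oo --> a -> (forall s, (K <= s)%N -> x <= a_ s + b_ s) ->
  x <= a + limn_einf b_.
Proof.
move=> afin aa xab; apply/lee_addgt0Pr => e e0.
rewrite addeAC -leeBlDl ?fin_numD ?afin//.
have [N _ NP] : \forall s \near \oo, a_ s < a + e%:E.
  by apply: (aa [set y | y < a + e%:E]); apply: open_ereal_lt'; rewrite lteDl// lte_fin.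
apply: (le_limn_einf_near (K := maxn K N)) => s; rewrite geq_max => /andP[Ks Ns].
rewrite leeBlDl ?fin_numD ?afin//; apply: le_trans (xab s Ks) _.
by apply: leeD => //; exact: ltW (NP s Ns).
Qed.

Section admissible_decompositions.
Context d (T : measurableType d) (R : realType) (mu : {measure set T -> \bar R}).
Variables (r : R) (G : nat -> set T) (w : nat -> R) (C : R).
Local Notation "'N_[ f ]" := (Lnorm mu r%:E f) (format "''N_[' f ]").

(** With [G] a sequence of cubes and [w i] the appropriate power of the volume
of [G i], an admissible [xi] dominates [f] by a sum of multiples of blocks, the
[i]-th one living on [G i], with [C] as a bound of the sum of the
coefficients.  Domination instead of equality is what makes this class stable
under limits; [greedy_summands] recovers equality in the end. *)
Definition admissible (f : T -> \bar R) (xi : nat -> T -> R) : Prop :=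
  [/\ forall i, measurable_fun setT (xi i),
      forall i x, (0 <= xi i x)%R,
      forall i x, ~ G i x -> xi i x = 0%R,
      \sum_(i <oo) (w i)%:E * 'N_[EFin \o xi i] <= C%:E &
      {ae mu, forall x, f x <= \sum_(i <oo) (xi i x)%:E}].

Hypothesis r1 : (1 <= r)%R.
Hypothesis w0 : forall i, (0 < w i)%R.

Let weighted_ge0 (u : nat -> T -> \bar R) i : 0 <= (w i)%:E * 'N_[u i].
Proof. by rewrite mule_ge0 ?Lnorm_ge0// lee_fin ltW. Qed.

Lemma admissible_mid f xi zeta : admissible f xi -> admissible f zeta ->
  admissible f (fun i x => (xi i x + zeta i x) / 2)%R.
Proof.
move=> [m1 p1 s1 n1 f1] [m2 p2 s2 n2 f2].
have half0 : (0 <= 2^-1 :> R)%R by rewrite invr_ge0.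
split.
- by move=> i; apply: measurable_funM => //; exact: measurable_funD.
- by move=> i x; rewrite divr_ge0// addr_ge0.
- by move=> i x Gx; rewrite s1// s2// addr0 mul0r.
- apply: (@le_trans _ _ (\sum_(i <oo) (2^-1%:E * ((w i)%:E * 'N_[EFin \o xi i]) +
                                     2^-1%:E * ((w i)%:E * 'N_[EFin \o zeta i])))).
    apply: lee_nneseries => [i _ _|i _].
      exact: (weighted_ge0 (fun i x => ((xi i x + zeta i x) / 2)%:E)).
    rewrite !(muleCA 2^-1%:E) -ge0_muleDr ?mule_ge0 ?Lnorm_ge0//.
    apply: lee_wpmul2l; first by rewrite lee_fin ltW.
    rewrite -!LnormZ_ge0//.
    apply: le_trans (minkowski_EFin mu _ _ r1); last 2 first.
    + exact: measurable_funM.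
    + exact: measurable_funM.
    rewrite le_eqVlt; apply/predU1P; left; apply: eq_Lnorm => x /=.
    by congr _%:E; field.
  have wxi := weighted_ge0 (fun i => EFin \o xi i).
  have wzeta := weighted_ge0 (fun i => EFin \o zeta i).
  rewrite nneseriesD; [|by move=> i _ _; apply: mule_ge0 => //; exact: wxi
                      |by move=> i _ _; apply: mule_ge0 => //; exact: wzeta].
  rewrite nneseriesZl; last by move=> i _; exact: wxi.
  rewrite nneseriesZl; last by move=> i _; exact: wzeta.
  rewrite -ge0_muleDr; [|by apply: nneseries_ge0 => i _ _; exact: wxi
                       |by apply: nneseries_ge0 => i _ _; exact: wzeta].
  rewrite lee_pdivrMl//.
  have -> : 2%:E * C%:E = C%:E + C%:E by rewrite -EFinM -EFinD; congr _%:E; ring.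
  exact: leeD.
- apply: filterS2 f1 f2 => x f1 f2.
  under eq_eseriesr do rewrite mulrC EFinM EFinD.
  rewrite nneseriesZl; last by move=> i _; rewrite -EFinD lee_fin addr_ge0.
  rewrite nneseriesD; [|by move=> i _ _; rewrite lee_fin|by move=> i _ _; rewrite lee_fin].
  rewrite lee_pdivlMl//; apply: le_trans (leeD f1 f2).
  by rewrite mule_natl mule2n.
Qed.


Hypothesis mG : forall i, measurable (G i).
Hypothesis finG : forall i, mu (G i) < +oo.
Variables (f : nat -> T -> \bar R) (B : nat -> set T).
(* The hypothesis tail says that, on each B l, pieces living on far sets G i are
   negligible in L^1 compared with their cost, so that no mass escapes to
   infinity in the index i. *)
Hypothesis f_nondecreasing : {ae mu, forall x, nondecreasing_seq (f ^~ x)}.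
Hypothesis f_admissible : forall k, exists xi, admissible (f k) xi.
Hypothesis mB : forall l, measurable (B l).
Hypothesis B_cover : forall x, exists l, B l x.
Hypothesis tail : forall l (e : R), (0 < e)%R -> exists N, forall i, (N <= i)%N ->
  forall u : T -> R, measurable_fun setT u -> (forall x, 0 <= u x)%R ->
    (forall x, ~ G i x -> u x = 0%R) ->
    \int[mu]_(x in B l) (u x)%:E <= e%:E * ((w i)%:E * 'N_[EFin \o u]).

(** The bound is uniform in [k] and in the decomposition. *)
Lemma integral_tail_le l (e : R) : (0 < e)%R -> exists N0, forall N, (N0 <= N)%N ->
  forall k xi, admissible (f k) xi ->
  \int[mu]_(x in B l) (\sum_(N <= i <oo) (xi i x)%:E) <= (e * C)%:E.
Proof.
move=> e0; have [N0 N0P] := tail l e0; exists N0 => N N0N k xi [mxi xi0 xiG xiC _].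
rewrite (eq_integral (fun x => \sum_(i <oo) (xi (i + N)%N x)%:E)); last first.
  move=> x _.
  by rewrite (nneseries_addn N (f := fun i => (xi i x)%:E))// => i; rewrite lee_fin.
rewrite integral_nneseries//; last 2 first.
- by move=> i; apply/measurable_EFinP; exact: measurable_funTS.
- by move=> i x _; rewrite lee_fin.
rewrite EFinM.
apply: (@le_trans _ _ (e%:E * \sum_(i <oo) (w i)%:E * 'N_[EFin \o xi i])); last first.
  by apply: lee_wpmul2l => //; rewrite lee_fin ltW.
rewrite -nneseriesZl; last by move=> i _; exact: (weighted_ge0 (fun i => EFin \o xi i)).
have ewn i : 0 <= e%:E * ((w i)%:E * 'N_[EFin \o xi i]).
  by apply: mule_ge0; [rewrite lee_fin ltW|exact: (weighted_ge0 (fun i => EFin \o xi i))].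
apply: (@le_trans _ _ (\sum_(i <oo) e%:E * ((w (i + N)%N)%:E * 'N_[EFin \o xi (i + N)%N]))).
  apply: lee_nneseries => [i _ _|i _].
    by apply: integral_ge0 => x _; rewrite lee_fin.
  by apply: N0P => //; [exact: leq_trans (leq_addl _ _)|exact: xiG].
rewrite (nneseries_addn N ewn).
rewrite [leRHS](nneseries_split 0 N)//.
by rewrite add0n; apply: leeDr; apply: sume_ge0 => i _; exact: ewn.
Qed.

(** Compactness: the classes of admissible decompositions of the [f k] decrease,
and they have a common element.  It is the limit [E] of the sequence given by
[komlos].  The cost of [E] is controlled by Fatou, and [E] still dominates every
[f k] because the part of the decompositions beyond an index [N], whose lower
limit is [L N], disappears when [N] grows. *)
Lemma admissible_lim : exists xi, forall k, admissible (f k) xi.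
Proof.
pose P k := [set xi | admissible (f k) xi].
have Pdec k m : (k <= m)%N -> P m `<=` P k.
  move=> km xi [mxi xi0 xiG xiC xif]; split => //.
  by apply: filterS2 f_nondecreasing xif => x fx; apply: le_trans; exact: fx.
have [eta [Peta cvgeta]] : exists eta : nat -> nat -> T -> R, (forall s, P s (eta s)) /\
  forall i, {ae mu, forall x, G i x -> cvgn (fun s => (eta s i x)%:E)}.
  apply: komlos => //.
  - by move=> k xi i [].
  - by move=> k xi i x [].
  - by move=> k xi zeta; exact: admissible_mid.
have meta s i : measurable_fun setT (EFin \o eta s i).
  by apply/measurable_EFinP; case: (Peta s).
have eta0 s i x : 0 <= (eta s i x)%:E by rewrite lee_fin; case: (Peta s).
pose E i x := limn_einf (fun s => (eta s i x)%:E).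
have mE i : measurable_fun setT (E i).
  by apply: (measurable_limn_einf (f := fun s x => (eta s i x)%:E)) => s; exact: meta.
have E0 i x : 0 <= E i x by apply: limn_einf_ge0 => s; exact: eta0.
have EC : \sum_(i <oo) (w i)%:E * 'N_[E i] <= C%:E.
  apply: (@le_trans _ _ (\sum_(i <oo) limn_einf (fun s => (w i)%:E * 'N_[EFin \o eta s i]))).
    apply: lee_nneseries => [i _ _|i _]; first exact: weighted_ge0.
    apply: le_trans (mule_limn_einf_le (ltW (w0 i)) _); last first.
      by move=> s; exact: Lnorm_ge0.
    apply: lee_wpmul2l; first by rewrite lee_fin ltW.
    by apply: (Lnorm_fatou mu r1 (u := fun s => EFin \o eta s i)) => // s x; exact: eta0.
  apply: le_trans (nneseries_limn_einf _) _ => [s i|].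
    exact: (weighted_ge0 (fun i => EFin \o eta s i)).
  by apply: limn_einf_le_ub => s; case: (Peta s).
have Efin : {ae mu, forall x, forall i, E i x \is a fin_num}.
  apply: ae_foralln => i; apply: (Lnorm_lty_ae r1) => //.
  have : (w i)%:E * 'N_[E i] < +oo.
    apply: le_lt_trans (ltry C); apply: le_trans EC.
    rewrite (nneseriesD1 (n := i))//.
    by apply: leeDl; apply: nneseries_ge0 => j _ _; exact: weighted_ge0.
  case: ('N_[E i]) (Lnorm_ge0 mu r%:E (E i)) => [a _ _| |]//; first exact: ltry.
  by rewrite gt0_muley ?lte_fin.
exists (fun i x => fine (E i x)) => k; split.
- by move=> i; apply: measurableT_comp => //.
- by move=> i x; exact: fine_ge0.
- move=> i x Gx; rewrite /E (_ : (fun s => _) = cst 0).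
    by rewrite (cvg_limn_einfE (cvg_cst 0)).
  by apply/funext => s; case: (Peta s) => _ _ /(_ i x Gx) -> _ _.
- apply: le_trans EC; apply: lee_nneseries => [i _ _|i _].
    exact: (weighted_ge0 (fun i => EFin \o (fine \o E i))).
  apply: lee_wpmul2l; first by rewrite lee_fin ltW.
  apply: le_Lnorm => //.
    by apply/measurable_EFinP; apply: measurableT_comp => //.
  by apply: aeW => x /=; case: (E i x) => [a| |]//=; rewrite ?normr0 ?leey.
(* It remains to prove that the limit dominates f k. *)
pose rem s N x := \sum_(N <= i <oo) (eta s i x)%:E.
have rem0 s N x : 0 <= rem s N x by exact: nneseries_ge0.
have mrem s N : measurable_fun setT (rem s N).
  rewrite (_ : rem s N = fun x => \sum_(i <oo) (eta s (i + N)%N x)%:E).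
    by apply: measurable_nneseries => [i x _|i]; [exact: eta0|exact: meta].
  by apply/funext => x; rewrite /rem -nneseries_addn.
pose L N x := limn_einf (fun s => rem s N x).
have L0 N x : 0 <= L N x by apply: limn_einf_ge0 => s; exact: rem0.
have mL N : measurable_fun setT (L N).
  by apply: (measurable_limn_einf (f := fun s x => rem s N x)) => s; exact: mrem.
pose M x := limn_einf (fun N => L N x).
have M0 x : 0 <= M x by apply: limn_einf_ge0 => s; exact: L0.
have mM : measurable_fun setT M by apply: (measurable_limn_einf (f := L)) => N; exact: mL.
have C0 : (0 <= C)%R.
  by rewrite -lee_fin; apply: le_trans EC; apply: nneseries_ge0 => i _ _; exact: weighted_ge0.
have IM l : \int[mu]_(x in B l) M x = 0.
  apply/eqP; rewrite eq_le integral_ge0 ?andbT//.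
  apply/lee_addgt0Pr => e e0; rewrite add0e.
  have d0 : (0 < e / (C + 1))%R by rewrite divr_gt0// ltr_wpDl.
  have [N0 N0P] := integral_tail_le l d0.
  apply: (@le_trans _ _ (limn_einf (fun N => \int[mu]_(x in B l) L N x))).
    by apply: fatou => // N; exact: measurable_funTS.
  apply: limn_einf_le_inf_often => K; exists (maxn K N0); first exact: leq_maxl.
  apply: (@le_trans _ _ (limn_einf (fun s => \int[mu]_(x in B l) rem s (maxn K N0) x))).
    by apply: fatou => // s; exact: measurable_funTS.
  apply: limn_einf_le_ub => s; apply: le_trans (N0P _ (leq_maxr _ _) _ _ (Peta s)) _.
  by rewrite lee_fin mulrAC ler_pdivrMr ?ltr_wpDl// ler_pM2l// lerDl.
have M_eq0 : {ae mu, forall x, M x = 0}.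
  have : {ae mu, forall x, forall l, B l x -> M x = 0}.
    apply: ae_foralln => l; apply/ae_eq_integral_abs => //.
      exact: measurable_funTS.
    by under eq_integral do rewrite gee0_abs//.
  by apply: filterS => x Mx; have [l Bl] := B_cover x; exact: Mx Bl.
have etaf : {ae mu, forall x, forall s, f s x <= \sum_(i <oo) (eta s i x)%:E}.
  by apply: ae_foralln => s; case: (Peta s).
have {}cvgeta : {ae mu, forall x, forall i, G i x -> cvgn (fun s => (eta s i x)%:E)}.
  exact: ae_foralln.
apply: filterS2 (filterI M_eq0 f_nondecreasing) (filterI etaf (filterI cvgeta Efin)).
move=> x [Mx fx] [fe [ce Ef]].
under eq_eseriesr do rewrite fineK//.
have {}ce i : (fun s => (eta s i x)%:E) @ \oo --> E i x.
  have ci : cvgn (fun s => (eta s i x)%:E).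
    have [/ce//|Gx] := pselect (G i x).
    rewrite (_ : (fun s => _) = cst 0); first exact: is_cvg_cst.
    by apply/funext => s; case: (Peta s) => _ _ /(_ i x Gx) -> _ _.
  by rewrite /E (cvg_limn_einfE ci).
set S := \sum_(i <oo) E i x.
have [->|Soo] := eqVneq S +oo; first by rewrite leey.
have S0 : 0 <= S by exact: nneseries_ge0.
have Sfin : S \is a fin_num by rewrite ge0_fin_numE// ltey.
have fSL N : f k x <= S + L N x.
  apply: (@le_trans _ _ (\sum_(0 <= i < N) E i x + L N x)); last first.
    by rewrite leeD2r//; apply: nneseries_lim_ge.
  apply: (@le_add_of_limn_einf _ _ _ (fun s => \sum_(0 <= i < N) (eta s i x)%:E) _ k).
  - by apply/sum_fin_numP => i _ _.
  - by apply: cvg_nnesum => // i _; exact: nearW.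
  - move=> s ks; apply: le_trans (fx _ _ ks) _; apply: le_trans (fe s) _.
    by rewrite (nneseries_split 0 N)// add0n.
have {}fSL N : f k x - S <= L N x by rewrite leeBlDl.
rewrite -[leRHS]adde0 -Mx -leeBlDl//.
by apply: (le_limn_einf_near (K := 0%N)) => N _; exact: fSL.
Qed.

End admissible_decompositions.

(** * Regrouping and localizing *)

Lemma nneseries_pick (R : realType) (j : nat) (a : \bar R) : 0 <= a ->
  \sum_(i <oo) (if j == i then a else 0) = a.
Proof.
move=> a0; rewrite (nneseriesD1 (n := j))//; last by move=> i _; case: ifP.
rewrite eqxx eseries0 ?adde0// => i _ /=.
by rewrite eq_sym => /negbTE ->.
Qed.

Section regroup.
Context d (T : measurableType d) (R : realType) (mu : {measure set T -> \bar R}).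
Variables (r : R) (G : nat -> set T) (w : nat -> R) (C : R).
Local Notation "'N_[ f ]" := (Lnorm mu r%:E f) (format "''N_[' f ]").
Hypothesis r1 : (1 <= r)%R.
Hypothesis w0 : forall i, (0 < w i)%R.

(** Infinitely many summands may live on the same set [G i]; they are added up,
and Minkowski's inequality shows that this does not increase the cost. *)
Lemma admissible_of_series (f : T -> \bar R) (u : nat -> T -> R) (iota : nat -> nat) :
  (forall j, measurable_fun setT (u j)) -> (forall j x, 0 <= u j x)%R ->
  (forall j x, ~ G (iota j) x -> u j x = 0%R) ->
  \sum_(j <oo) (w (iota j))%:E * 'N_[EFin \o u j] <= C%:E ->
  {ae mu, forall x, f x <= \sum_(j <oo) (u j x)%:E} ->
  exists xi, admissible mu r G w C f xi.
Proof.
move=> mu_ u0 uG uC fu.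
pose v i j x := if iota j == i then u j x else 0%R.
have v0 i j x : (0 <= v i j x)%R by rewrite /v; case: ifP.
have mv i j : measurable_fun setT (v i j) by rewrite /v; case: (iota j == i).
pose h i x := \sum_(j <oo) (v i j x)%:E.
have h0 i x : 0 <= h i x by apply: nneseries_ge0 => j _ _; rewrite lee_fin.
have mh i : measurable_fun setT (h i).
  apply: measurable_nneseries => [j x _|j]; first by rewrite lee_fin.
  exact/measurable_EFinP.
have whC : \sum_(i <oo) (w i)%:E * 'N_[h i] <= C%:E.
  pose a i j : \bar R := if iota j == i then (w (iota j))%:E * 'N_[EFin \o u j] else 0.
  have a0 i j : 0 <= a i j.
    by rewrite /a; case: ifP => // _; rewrite mule_ge0 ?Lnorm_ge0// lee_fin ltW.
  apply: (@le_trans _ _ (\sum_(i <oo) \sum_(j <oo) a i j)).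
    apply: lee_nneseries => [i _ _|i _].
      by rewrite mule_ge0 ?Lnorm_ge0// lee_fin ltW.
    apply: (@le_trans _ _ ((w i)%:E * \sum_(j <oo) 'N_[EFin \o v i j])).
      apply: lee_wpmul2l; first by rewrite lee_fin ltW.
      exact: Lnorm_nneseries.
    rewrite -nneseriesZl; last by move=> j _; exact: Lnorm_ge0.
    apply: lee_nneseries => [j _ _|j _].
      by rewrite mule_ge0 ?Lnorm_ge0// lee_fin ltW.
    rewrite /a /v; case: eqP => [->//|_].
    by rewrite (Lnorm0 mu (p := r%:E)) ?mule0// gt_eqF// lte_fin (lt_le_trans _ r1).
  rewrite nneseries_interchange//; apply: le_trans uC.
  apply: lee_nneseries => [j _ _|j _]; first exact: nneseries_ge0.
  by rewrite nneseries_pick// mule_ge0 ?Lnorm_ge0// lee_fin ltW.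
have hfin : {ae mu, forall x, forall i, h i x \is a fin_num}.
  apply: ae_foralln => i; apply: (Lnorm_lty_ae r1) => //.
  have whi j : 0 <= (w j)%:E * 'N_[h j] by rewrite mule_ge0 ?Lnorm_ge0// lee_fin ltW.
  have : (w i)%:E * 'N_[h i] < +oo.
    apply: le_lt_trans (ltry C); apply: le_trans whC.
    rewrite (nneseriesD1 (n := i))//.
    by apply: leeDl; apply: nneseries_ge0.
  case: ('N_[h i]) (Lnorm_ge0 mu r%:E (h i)) => [a _ _| |]//; first exact: ltry.
  by rewrite gt0_muley ?lte_fin.
exists (fun i x => fine (h i x)); split.
- by move=> i; apply: measurableT_comp => //.
- by move=> i x; exact: fine_ge0.
- move=> i x Gx; rewrite /h eseries0// => j _ _; rewrite /v.
  by case: eqP => // ij; rewrite uG// ij.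
- apply: le_trans whC; apply: lee_nneseries => [i _ _|i _].
    by rewrite mule_ge0 ?Lnorm_ge0// lee_fin ltW.
  apply: lee_wpmul2l; first by rewrite lee_fin ltW.
  apply: le_Lnorm => //.
    by apply/measurable_EFinP; apply: measurableT_comp => //.
  by apply: aeW => x /=; case: (h i x) => [a| |]//=; rewrite ?normr0 ?leey.
- apply: filterS2 hfin fu => x hx; move=> /le_trans; apply.
  under [leRHS]eq_eseriesr do rewrite fineK//.
  rewrite /h nneseries_interchange; last by move=> i j; rewrite lee_fin.
  apply: lee_nneseries => [j _ _|j _]; first by rewrite lee_fin.
  under eq_eseriesr do rewrite /v (fun_if EFin).
  by rewrite nneseries_pick// lee_fin.
Qed.
End regroup.

(** Hoelder's inequality against the indicator function of [B `&` G]. *)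
Lemma integral_le_Lnorm d (T : measurableType d) (R : realType)
    (mu : {measure set T -> \bar R}) (r q : R) (G B : set T) (u : T -> R) :
  (0 < r)%R -> (0 < q)%R -> (r^-1 + q^-1 = 1)%R ->
  measurable G -> measurable B -> measurable_fun setT u ->
  (forall x, 0 <= u x)%R -> (forall x, ~ G x -> u x = 0%R) ->
  \int[mu]_(x in B) (u x)%:E <=
    Lnorm mu r%:E (EFin \o u) * mu (B `&` G) `^ q^-1.
Proof.
move=> r0 q0 rq mG mB mu_ u0 uG.
have mBG : measurable (B `&` G) by exact: measurableI.
have := hoelder mu mu_ (measurable_indic mBG) r0 q0 rq.
rewrite Lnorm1.
have -> : Lnorm mu q%:E (EFin \o \1_(B `&` G)) = mu (B `&` G) `^ q^-1.
  rewrite unlock; congr (_ `^ _).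
  rewrite -(setIT (B `&` G)) -integral_indic//; apply: eq_integral => x _ /=.
  rewrite !indicE !setIT; case: (_ \in _) => /=; first by rewrite normr1 powR1.
  by rewrite normr0 powR0// gt_eqF.
apply: le_trans; rewrite integral_mkcond; apply: ge0_le_integral => //.
- by move=> x _; rewrite patchE; case: ifP => // _; rewrite lee_fin.
- by apply/(measurable_restrictT _ mB); apply: measurable_funTS; exact/measurable_EFinP.
- apply: measurableT_comp => //; apply/measurable_EFinP.
  by apply: measurable_funM => //; exact: measurable_indic.
move=> x _; rewrite patchE; case: ifPn => [|_]; last by rewrite abse_ge0.
rewrite inE => Bx; have [Gx|Gx] := pselect (G x).
  rewrite /= indicE mem_set//= mulr1 lee_fin; exact: ler_norm.
by rewrite uG// abse_ge0.
Qed.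

Lemma integral_setC_small d (T : measurableType d) (R : realType)
    (mu : {measure set T -> \bar R}) (K : nat -> set T) (g : T -> \bar R) :
  (forall N, measurable (K N)) -> nondecreasing_seq K -> \bigcup_N K N = setT ->
  measurable_fun setT g -> (forall x, 0 <= g x) -> \int[mu]_x g x < +oo ->
  forall (j : nat) (e : R), (0 < e)%R ->
    exists2 N, (j <= N)%N & \int[mu]_(x in ~` K N) g x <= e%:E.
Proof.
move=> mK ndK KT mg g0 goo j e e0.
have Kg := @ge0_nondecreasing_set_cvg_integral _ _ _ K g mu ndK mK
  (fun i => measurable_funTS mg) (fun i x _ => g0 x).
rewrite KT in Kg.
have gfin : \int[mu]_x g x \is a fin_num by rewrite ge0_fin_numE// integral_ge0.
have [N0 _ NP] : \forall N \near \oo, \int[mu]_x g x - e%:E < \int[mu]_(x in K N) g x.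
  apply: (Kg [set y | \int[mu]_x g x - e%:E < y]); apply: open_ereal_gt'.
  by rewrite lteBlDr// lteDl// lte_fin.
exists (maxn j N0); first exact: leq_maxl.
have := NP _ (leq_maxr j N0) => /=; set N := maxn j N0.
have -> : \int[mu]_x g x = \int[mu]_(x in K N) g x + \int[mu]_(x in ~` K N) g x.
  rewrite -ge0_integral_setU ?setUv//; first exact: measurableC.
  by rewrite disj_set2E setICr.
have : \int[mu]_(x in K N) g x \is a fin_num.
  rewrite ge0_fin_numE ?integral_ge0//; apply: le_lt_trans goo.
  exact: ge0_subset_integral.
case: (\int[mu]_(x in K N) g x) => // a _.
have : 0 <= \int[mu]_(x in ~` K N) g x by exact: integral_ge0.
case: (\int[mu]_(x in ~` K N) g x) => [b| |]//= _.
by rewrite -!EFinD lte_fin lee_fin; lra.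
Qed.

(** * Domination by blocks *)

Lemma conj_expVD (R : realType) (q : R) : ((conj_exp q)^-1 + q^-1 = 1)%R.
Proof. by rewrite /conj_exp invrK subrK. Qed.

Lemma conj_exp_gt1 (R : realType) (q : R) : (1 < q)%R -> (1 < conj_exp q)%R.
Proof.
move=> q1; have q0 : (0 < q)%R by exact: lt_trans q1.
have qV0 : (0 < q^-1)%R by rewrite invr_gt0.
by rewrite /conj_exp invf_gt1 ?subr_gt0 ?invf_lt1// ltrBlDr ltrDl.
Qed.

(** The sequence is eventually equal to [a] unless [S] stays below [a], in which
case [l = a]. *)
Lemma cvg_mine_nondecreasing (R : realType) (a : \bar R) (S : (\bar R)^nat) l :
  nondecreasing_seq S -> S @ \oo --> l -> a <= l ->
  mine a (S N) @[N --> \oo] --> a.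
Proof.
move=> ndS Sl al; have [[N aN]|aS] := pselect (exists N, a <= S N).
  apply: cvg_near_cst; exists N => // m Nm /=.
  by rewrite min_l// (le_trans aN)// ndS.
have {}aS N : S N <= a.
  by apply/ltW; rewrite ltNge; apply/negP => aN; apply: aS; exists N.
have -> : (fun N => mine a (S N)) = S by apply/funext => N; rewrite min_r.
have -> : a = l by apply/eqP; rewrite eq_le al/=; apply: cvge_to_le Sl _; exact: nearW.
exact: Sl.
Qed.

(** The summands are used greedily: [v j] is the increment of
[min (f, u 0 + ... + u (j - 1))], so the partial sums telescope to that minimum.
Contrary to a rescaling of the [u j] by the quotient of [f] and the sum of the
[u j], this also works where [f] or the sum is infinite. *)
Lemma greedy_summands d (T : measurableType d) (R : realType)
    (f : T -> \bar R) (u : nat -> T -> R) :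
  measurable_fun setT f -> (forall j, measurable_fun setT (u j)) ->
  (forall j x, 0 <= u j x)%R ->
  exists v : nat -> T -> R,
    [/\ forall j, measurable_fun setT (v j),
        forall j x, (0 <= v j x <= u j x)%R &
        forall x, 0 <= f x -> f x <= \sum_(j <oo) (u j x)%:E ->
          (\sum_(0 <= k < N) v k x)%:E @[N --> \oo] --> f x].
Proof.
move=> mf mu_ u0.
pose S N x := (\sum_(0 <= j < N) u j x)%R.
have S0 N x : (0 <= S N x)%R by apply: sumr_ge0.
have mS N : measurable_fun setT (S N) by exact: measurable_sum.
(* The positive part of f makes the minimum nonnegative everywhere, hence
   finite, although f is only required to be nonnegative at the points where
   convergence is claimed. *)
pose g N x := fine (mine (maxe (f x) 0) (S N x)%:E).
have gE N x : (g N x)%:E = mine (maxe (f x) 0) (S N x)%:E.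
  rewrite fineK// ge0_fin_numE.
    by rewrite gt_min ltry orbT.
  by rewrite le_min le_max lexx orbT lee_fin S0.
have mg N : measurable_fun setT (g N).
  apply: measurableT_comp => //.
  apply: measurable_mine; last exact/measurable_EFinP.
  exact: measurable_maxe.
exists (fun j x => g j.+1 x - g j x)%R; split.
- by move=> j; exact: measurable_funB.
- move=> N x.
  have SS : S N.+1 x = (S N x + u N x)%R by rewrite /S big_nat_recr.
  have := gE N x; have := gE N.+1 x; rewrite SS.
  have := u0 N x; have := S0 N x.
  have : 0 <= maxe (f x) 0 by rewrite le_max lexx orbT.
  case: (maxe (f x) 0) => [a| |]// a0 s0 un.
    rewrite -!EFin_min => -[->] [->]; rewrite /Num.min.
    by do 2 case: ltP => ?; apply/andP; split; lra.
  by rewrite !min_r ?leey// => -[->] [->]; apply/andP; split; lra.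
- move=> x fx0 fxu.
  rewrite (_ : (fun N => _) = fun N => mine (f x) (S N x)%:E); last first.
    apply/funext => N; rewrite -{1}(max_l fx0) -gE; congr _%:E.
    rewrite telescope_sumr// (_ : g 0%N x = 0%R) ?subr0//.
    apply/EFin_inj; rewrite gE /S big_geq// min_r//.
    by rewrite le_max lexx orbT.
  apply: (cvg_mine_nondecreasing _ _ fxu).
    move=> N M NM; rewrite lee_fin /S (big_cat_nat _ NM)//= lerDl.
    exact: sumr_ge0.
  rewrite (_ : (fun N => (S N x)%:E) = fun N => \sum_(0 <= j < N) (u j x)%:E).
    by apply: is_cvg_nneseries => j _ _; rewrite lee_fin.
  by apply/funext => N; rewrite /S sumEFin.
Qed.

Section block_norm_le.
Context (R : realType) (n : nat).
Local Notation mu := (lebesgue_Rn R n).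
Variables (p q : R).
Hypothesis q1 : (1 < q)%R.
Let r := conj_exp q.
Let r1 : (1 <= r)%R. Proof. exact/ltW/conj_exp_gt1. Qed.
Let r0 : (0 < r)%R. Proof. exact: lt_le_trans r1. Qed.
Local Notation "'N_[ f ]" := (Lnorm mu r%:E f) (format "''N_[' f ]").

Lemma cube_measurable (Q : set (Rn R n)) : is_cube Q -> measurable Q.
Proof.
by move=> [a [l [l0 ->]]]; apply: measurable_box => i; rewrite lerDl ltW.
Qed.

Lemma cube_volume (Q : set (Rn R n)) : is_cube Q -> exists2 v : R,
  (0 < v)%R & mu Q = v%:E.
Proof.
move=> [a [l [l0 ->]]]; exists (\prod_(i < n) (a i + l - a i))%R.
  by apply: prodr_gt0 => i _; rewrite addrAC subrr add0r.
by apply: lebesgue_Rn_box => i; rewrite lerDl ltW.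
Qed.

(** The integral over [Q] in the definition of a block may be taken over the
whole space, because [b] vanishes outside of [Q]. *)
Lemma is_blockP (b : Rn R n -> R) (Q : set (Rn R n)) : is_cube Q ->
  measurable_fun setT b -> (forall x, ~ Q x -> b x = 0%R) ->
  'N_[EFin \o b] <= mu Q `^ (p^-1 - q^-1) -> is_block p q b.
Proof.
move=> cQ mb bQ bn; split => //; exists Q; split => //.
apply: le_trans bn; rewrite unlock; apply: le_poweR.
- by rewrite invr_ge0 ltW.
- by apply: integral_ge0 => x _; rewrite lee_fin powR_ge0.
apply: (@ge0_subset_integral _ _ _ mu Q setT _ _ (fun x => `|(b x)%:E| `^ r)).
- exact: cube_measurable.
- exact: measurableT.
- by apply: measurable_abse_poweR; exact/measurable_EFinP.
- by move=> x _; exact: poweR_ge0.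
- exact: subsetT.
Qed.

Lemma is_block_Lnorm (b : Rn R n -> R) : is_block p q b -> exists Q,
  [/\ is_cube Q, forall x, ~ Q x -> b x = 0%R &
    'N_[EFin \o b] <= mu Q `^ (p^-1 - q^-1)].
Proof.
move=> [mb [Q [cQ bQ bn]]]; exists Q; split => //.
apply: le_trans bn; rewrite unlock.
rewrite [X in X `^ _ <= _](_ : _ = \int[mu]_(x in Q) ((`|b x| `^ r)%R)%:E)//.
rewrite [RHS]integral_mkcond; apply: eq_integral => x _ /=; rewrite patchE.
case: ifPn => //; rewrite notin_setE => /bQ ->.
by rewrite normr0 powR0// gt_eqF.
Qed.

(** The block space norm is a lattice norm: a domination of [f] by multiples of
blocks is as good as a decomposition, thanks to [greedy_summands]. *)
Lemma block_norm_le (f : Rn R n -> \bar R) (u : nat -> Rn R n -> R)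
    (Q : nat -> set (Rn R n)) (lam : nat -> R) :
  measurable_fun setT f -> {ae mu, forall x, 0 <= f x} ->
  (forall j, is_cube (Q j)) -> (forall j, measurable_fun setT (u j)) ->
  (forall j x, 0 <= u j x)%R -> (forall j x, ~ Q j x -> u j x = 0%R) ->
  (forall j, 0 <= lam j)%R ->
  (forall j, 'N_[EFin \o u j] <= (lam j)%:E * mu (Q j) `^ (p^-1 - q^-1)) ->
  {ae mu, forall x, f x <= \sum_(j <oo) (u j x)%:E} ->
  block_norm p q f <= \sum_(j <oo) (lam j)%:E.
Proof.
move=> mf f0 cQ mu_ u0 uQ lam0 ulam fu.
have [->|lamoo] := eqVneq (\sum_(j <oo) (lam j)%:E) +oo; first by rewrite leey.
apply/lee_addgt0Pr => e e0.
(* The coefficients are made positive so that one can divide by them. *)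
pose lam' j : R := (lam j + e / (2 ^ j.+1)%:R)%R.
have lam'0 j : (0 < lam' j)%R by rewrite ltr_wpDl// divr_gt0.
have lam'le : \sum_(j <oo) (lam' j)%:E <= \sum_(j <oo) (lam j)%:E + e%:E.
  under eq_eseriesr do rewrite EFinD.
  by apply: (epsilon_trick xpredT _ (ltW e0)) => j; rewrite lee_fin.
apply: le_trans lam'le.
have [v [mv vu vf]] := greedy_summands mf mu_ u0.
pose b j x := ((lam' j)^-1 * v j x)%R.
have bblock j : is_block p q (b j).
  apply: (is_blockP (cQ j)).
  - exact: measurable_funM.
  - move=> x Qx; have := vu j x; rewrite uQ// => vx.
    by rewrite /b (_ : v j x = 0%R) ?mulr0//; apply/eqP; rewrite eq_le andbC.
  - have -> : EFin \o b j = fun x => ((lam' j)^-1 * v j x)%:E by [].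
    rewrite LnormZ_ge0//; last by rewrite invr_ge0 ltW.
    rewrite lee_pdivrMl//; apply: (@le_trans _ _ ('N_[EFin \o u j])).
      exact: le_Lnorm_EFin.
    apply: le_trans (ulam j) _; apply: lee_wpmul2r; first exact: poweR_ge0.
    by rewrite lee_fin lerDl divr_ge0// ltW.
have -> : \sum_(j <oo) (lam' j)%:E = \sum_(j <oo) `|lam' j|%:E.
  by apply: eq_eseriesr => j _; rewrite ger0_norm// ltW.
apply: ereal_inf_lbound; exists lam', b; split => //; split => //.
- under eq_eseriesr do rewrite ger0_norm ?ltW//.
  apply: le_lt_trans (_ : \sum_(j <oo) (lam j)%:E + e%:E < +oo).
    under eq_eseriesr do rewrite EFinD.
    by apply: (epsilon_trick xpredT _ (ltW e0)) => j; rewrite lee_fin.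
  by rewrite lte_add_pinfty ?ltry// ltey.
- apply: filterS2 f0 fu => x fx0 fxu.
  rewrite (_ : (fun N => _) = fun N => (\sum_(0 <= k < N) v k x)%:E); last first.
    apply/funext => N; congr _%:E; apply: eq_bigr => k _.
    by rewrite /b mulrA mulfV ?gt_eqF// mul1r.
  exact: vf.
Qed.

End block_norm_le.

(** * A grid of overlapping cubes *)

Section grid.
Context (R : realType) (n : nat).
Local Notation mu := (lebesgue_Rn R n).
Variable s : R.
Hypothesis s1 : (1 < s)%R.

Definition scale (j : int) : R := expR (j%:~R * ln s).

(** For [s > 1] the grid consists of the cubes of side [s ^ (j + 1)] whose lower
corner is in the lattice of mesh [(s - 1) * s ^ j].  The mesh is finer than the
side, so consecutive cubes overlap and every cube is contained in a grid cube
that is larger only by a factor [s ^ 2] in each direction, a factor which can be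
made as close to [1] as desired; disjoint dyadic cubes would lose a constant. *)
Definition grid_cube (jm : int * {ffun 'I_n -> int}) : set (Rn R n) :=
  box (fun i => (s - 1) * scale jm.1 * (jm.2 i)%:~R)%R
      (fun i => (s - 1) * scale jm.1 * (jm.2 i)%:~R + scale (jm.1 + 1))%R.

Lemma scale_gt0 j : (0 < scale j)%R. Proof. exact: expR_gt0. Qed.

Lemma scaleD1 j : scale (j + 1) = (s * scale j)%R.
Proof.
rewrite /scale intrD mulrDl mul1r expRD mulrC lnK//.
by rewrite posrE (lt_trans _ s1).
Qed.

Lemma scaleN j : scale (- j) = ((scale j)^-1)%R.
Proof. by rewrite /scale mulrNz mulNr expRN. Qed.

Lemma ler_scale j k : (j <= k)%R -> (scale j <= scale k)%R.
Proof. by move=> jk; rewrite ler_expR ler_wpM2r ?ler_int// ln_ge0// ltW. Qed.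

Lemma scale_ge_linear j : (j%:~R * ln s <= scale j)%R.
Proof. by apply: le_trans (expR_ge1Dx _); rewrite lerDr. Qed.

Lemma is_cube_grid jm : is_cube (grid_cube jm).
Proof.
by exists (fun i => (s - 1) * scale jm.1 * (jm.2 i)%:~R)%R, (scale (jm.1 + 1));
  split => //; exact: scale_gt0.
Qed.

Lemma grid_cube_volume jm : mu (grid_cube jm) = (scale (jm.1 + 1) ^+ n)%:E.
Proof.
rewrite /grid_cube lebesgue_Rn_box; last by move=> i; rewrite lerDl ltW// scale_gt0.
congr _%:E; under eq_bigr do rewrite addrAC subrr add0r.
by rewrite prodr_const card_ord.
Qed.

(** If the side [l] of [Q] satisfies [s ^ k <= l < s ^ (k + 1)], a grid cube of
side [s ^ (k + 2)] works: its lower corner is obtained by rounding that of [Q]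
down, which moves it by at most the mesh [(s - 1) * s ^ (k + 1)], and
[s ^ (k + 1) + (s - 1) * s ^ (k + 1) = s ^ (k + 2)]. *)
Lemma grid_cube_cover (Q : set (Rn R n)) : is_cube Q -> exists jm,
  Q `<=` grid_cube jm /\ mu (grid_cube jm) <= (s ^+ (2 * n))%:E * mu Q.
Proof.
move=> [a [l [l0 ->]]].
have s0 : (0 < s)%R by exact: lt_trans s1.
have L0 : (0 < ln s)%R by exact: ln_gt0.
pose k := Num.floor (ln l / ln s)%R.
have /andP[kl lk] := floor_itv (ln l / ln s)%R.
have scale_l : (scale k <= l)%R.
  by rewrite -[leRHS]lnK ?posrE// ler_expR -ler_pdivlMr.
have l_scale : (l <= scale (k + 1))%R.
  by rewrite -[leLHS]lnK ?posrE// ler_expR -ler_pdivrMr// ltW.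
pose D := ((s - 1) * scale (k + 1))%R.
have D0 : (0 < D)%R by rewrite mulr_gt0 ?subr_gt0// scale_gt0.
exists (k + 1, [ffun i => Num.floor (a i / D)%R])%R; split.
  move=> x xQ i /=; have /andP[ax xa] := xQ i; rewrite ffunE -/D.
  have /andP[Da aD] := floor_itv (a i / D)%R.
  rewrite intrD in aD; rewrite ler_pdivlMr// in Da; rewrite ltr_pdivrMr// in aD.
  rewrite (scaleD1 (k + 1)).
  have -> : (s * scale (k + 1) = D + scale (k + 1))%R by rewrite /D; ring.
  set m := (Num.floor _)%:~R in Da aD *.
  by apply/andP; split; lra.
rewrite grid_cube_volume /= lebesgue_Rn_box; last by move=> i; rewrite lerDl ltW.
under eq_bigr do rewrite addrAC subrr add0r.
rewrite prodr_const card_ord -EFinM lee_fin exprM -exprMn.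
apply: lerXn2r.
- by rewrite nnegrE ltW// scale_gt0.
- by rewrite nnegrE mulr_ge0 ?exprn_ge0// ltW.
by rewrite !scaleD1 mulrA -expr2 ler_pM2l// exprn_gt0.
Qed.

(** Up to finitely many indices, a grid cube [G] is very large, very small, or
far from the origin.  The first case uses [1/q - 1/p > 0], which is where
[q < p] is indispensable, the second one [1/p > 0], and in the third one [G]
does not meet the given box. *)
Lemma grid_cube_tail_small (p q : R) (l : nat) (e : R) :
  (0 < n)%N -> (1 < q)%R -> (q < p)%R -> (0 < e)%R ->
  exists K : nat, forall jm : int * {ffun 'I_n -> int},
    (K < `|jm.1|)%N \/ (exists i, (K < `|jm.2 i|)%N) ->
    mu (box (fun=> - l%:R)%R (fun=> l%:R)%R `&` grid_cube jm) `^ q^-1 <=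
      e%:E * mu (grid_cube jm) `^ (q^-1 - p^-1).
Proof.
move=> n0 q1 qp e0.
have q0 : (0 < q)%R by exact: lt_trans q1.
have p0 : (0 < p)%R by exact: lt_trans qp.
have s0 : (0 < s)%R by exact: lt_trans s1.
have L0 : (0 < ln s)%R by exact: ln_gt0.
set theta := (q^-1 - p^-1)%R.
have theta0 : (0 < theta)%R by rewrite subr_gt0 ltf_pV2.
set B := box _ _.
have l0 : (- l%:R <= l%:R :> R)%R by rewrite (@le_trans _ _ 0%R)// ?oppr_le0.
have mB : measurable B by exact: measurable_box.
have mG jm : measurable (grid_cube jm) by exact/cube_measurable/is_cube_grid.
have [V V0 BV] : exists2 V : R, (0 <= V)%R & mu B = V%:E.
  exists (\prod_(i < n) (l%:R - - l%:R))%R; last exact: lebesgue_Rn_box.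
  by apply: prodr_ge0 => i _; rewrite subr_ge0.
pose Y := ((V `^ q^-1 / e) `^ theta^-1)%R; pose Z := (e `^ (- p))%R.
have Y0 : (0 <= Y)%R by exact: powR_ge0.
have Z0 : (0 < Z)%R by exact: powR_gt0.
pose K1 := (Num.trunc ((Y + Z) / ln s)).+1.
have K1YZ : (Y + Z <= K1%:R * ln s)%R.
  by rewrite -ler_pdivrMr// ltW// truncnS_gt.
pose K2 := (Num.trunc ((l%:R * scale K1%:Z + s) / (s - 1))).+1.
have K2P : (l%:R * scale K1%:Z + s < K2%:R * (s - 1))%R.
  by rewrite -ltr_pdivrMr ?subr_gt0// truncnS_gt.
exists (maxn K1 K2) => -[j m] /= jmK.
rewrite grid_cube_volume /=; set v := (scale (j + 1) ^+ n)%R.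
have v0 : (0 < v)%R by rewrite exprn_gt0// scale_gt0.
have [jK1|K1j] := leqP `|j| K1; last first.
  have [j0|j0] := leP 0%R j.
    (* The box bounds the intersection, and the right-hand side is large. *)
    apply: (@le_trans _ _ ((V `^ q^-1)%R)%:E).
      rewrite -poweR_EFin -BV; apply: le_poweR => //; first by rewrite invr_ge0 ltW.
      by apply: le_measure; rewrite ?inE//; exact: measurableI.
    rewrite ?poweR_EFin -EFinM lee_fin -ler_pdivrMl// mulrC.
    have -> : (V `^ q^-1 / e = Y `^ theta)%R.
      by rewrite /Y -powRrM mulVf ?gt_eqF// powRr1// divr_ge0// ?powR_ge0// ltW.
    apply: ge0_ler_powR; rewrite ?nnegrE ?(ltW theta0) ?(ltW v0)//.
    have K1j1 : (K1%:R <= (j + 1)%:~R :> R)%R.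
      rewrite (_ : K1%:R = K1%:Z%:~R)// ler_int.
      apply: le_trans (_ : `|j|%R <= _)%R; last by rewrite ger0_norm// lerDl.
      by rewrite -abszE lez_nat ltnW.
    have YS : (Y <= scale (j + 1))%R.
      apply: le_trans (scale_ge_linear _).
      apply: le_trans (ler_wpM2r (ltW L0) K1j1); apply: le_trans K1YZ.
      by rewrite lerDl ltW.
    have S1 : (1 <= scale (j + 1))%R.
      have : (0 <= j + 1)%R by rewrite addr_ge0.
      by move=> /ler_scale; rewrite {1}/scale mul0r expR0.
    by apply: le_trans YS _; rewrite /v; apply: ler_eXnr.
  (* The cube bounds the intersection: split 1/q into theta + 1/p. *)
  apply: (@le_trans _ _ ((v `^ q^-1)%R)%:E).
    rewrite -poweR_EFin /v -(grid_cube_volume (j, m)).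
    apply: le_poweR => //; first by rewrite invr_ge0 ltW.
    by apply: le_measure; rewrite ?inE//; exact: measurableI.
  rewrite ?poweR_EFin -EFinM lee_fin.
  have -> : (q^-1 = theta + p^-1)%R by rewrite /theta subrK.
  rewrite powRD; last by rewrite gt_eqF ?implybT// addr_gt0// invr_gt0.
  rewrite [leRHS]mulrC; apply: ler_wpM2l; first exact: powR_ge0.
  have -> : e = ((e `^ p) `^ p^-1)%R.
    by rewrite -powRrM mulfV ?gt_eqF// powRr1// ltW.
  apply: ge0_ler_powR; rewrite ?nnegrE ?powR_ge0 ?(ltW v0) ?invr_ge0 ?(ltW p0)//.
  have K1j1 : (K1%:R <= (- (j + 1))%:~R :> R)%R.
    rewrite (_ : K1%:R = K1%:Z%:~R)// ler_int.
    rewrite opprD lerBrDr -(ltr0_norm j0) -abszE -PoszD lez_nat addn1//.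
  have ZS : (Z <= scale (- (j + 1)))%R.
    apply: le_trans (scale_ge_linear _).
    apply: le_trans (ler_wpM2r (ltW L0) K1j1); apply: le_trans K1YZ.
    by rewrite lerDr.
  have Se : (scale (j + 1) <= e `^ p)%R.
    have -> : scale (j + 1) = ((scale (- (j + 1)))^-1)%R by rewrite scaleN invrK.
    rewrite invf_ple ?posrE ?scale_gt0 ?powR_gt0//.
    by rewrite -powRN.
  have S1 : (scale (j + 1) <= 1)%R.
    have : (j + 1 <= 0)%R by rewrite lezD1.
    by move=> /ler_scale; rewrite {2}/scale mul0r expR0.
  apply: le_trans Se; rewrite /v; apply: ler_iXnr => //.
  exact/ltW/scale_gt0.
(* The side is bounded from both directions: only finitely many such cubes meet
   the box. *)
have [i K2i] : exists i, (K2 < `|m i|)%N.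
  case: jmK => [|[i mi]].
    by rewrite ltnNge (leq_trans jK1)// leq_maxl.
  by exists i; exact: leq_ltn_trans (leq_maxr _ _) mi.
suff -> : B `&` grid_cube (j, m) = set0.
  rewrite measure0 poweR0r; last by rewrite invr_eq0 gt_eqF.
  by rewrite ?poweR_EFin -EFinM lee_fin mulr_ge0 ?powR_ge0 ?ltW.
rewrite -subset0 => x [/(_ i)/andP[lx xl] /(_ i)/= /andP[]].
rewrite scaleD1; set t := Defs.coord x i => tm mt.
have Sj0 := scale_gt0 j; have SjK : (1 <= scale j * scale K1%:Z)%R.
  rewrite -ler_pdivrMl// mulr1 -scaleN; apply: ler_scale.
  by apply: le_trans (ler_norm _) _; rewrite normrN -abszE lez_nat.
have mK : (K2%:R <= `|(m i)%:~R| :> R)%R.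
  by rewrite -intr_norm -abszE ler_nat ltnW.
have : (`|(s - 1) * scale j * (m i)%:~R| <= l%:R + s * scale j)%R.
  rewrite ler_norml; have := mulr_gt0 s0 Sj0; move: mt tm lx xl.
  move: (_ * (m i)%:~R)%R (s * scale j)%R => y z mt tm lx xl z0.
  by rewrite opprD lerBlDr (le_trans lx mt) (le_trans (le_trans tm xl))// lerDl ltW.
rewrite normrM gtr0_norm ?mulr_gt0 ?subr_gt0//.
apply/negP; rewrite -ltNge.
have s10 : (0 < s - 1)%R by rewrite subr_gt0.
apply: (@lt_le_trans _ _ (scale j * (K2%:R * (s - 1))))%R; last first.
  by rewrite [leLHS](_ : _ = (s - 1) * scale j * K2%:R)%R ?ler_pM2l ?mulr_gt0//; ring.
apply: le_lt_trans (_ : (scale j * (l%:R * scale K1%:Z + s)) < _)%R; last by rewrite ltr_pM2l.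
have : (l%:R <= l%:R * (scale j * scale K1%:Z) :> R)%R by rewrite ler_peMr.
by rewrite mulrDr mulrCA (mulrC s) lerD2r.
Qed.

End grid.

Lemma grid_index_bounded (n K : nat) : exists N, forall i, (N <= i)%N ->
  forall jm : int * {ffun 'I_n -> int}, pickle_inv i = Some jm ->
    (K < `|jm.1|)%N \/ (exists i, (K < `|jm.2 i|)%N).
Proof.
pose shift (a : 'I_(K + K).+1) : int := (a%:Z - K%:Z)%R.
have shiftP (k : int) : (`|k| <= K)%N -> exists a, k = shift a.
  move=> kK; exists (inord (absz (k + K%:Z)%R)); rewrite /shift inordK; lia.
pose tau (ab : 'I_(K + K).+1 * {ffun 'I_n -> 'I_(K + K).+1}) :
  int * {ffun 'I_n -> int} := (shift ab.1, [ffun i => shift (ab.2 i)]).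
exists (\max_ab pickle (tau ab)).+1 => i Ni [j m] jm.
apply: contrapT => /not_orP[/negP jK mK].
have [a ja] : exists a, j = shift a by apply: shiftP; rewrite leqNgt.
have /choice[b mb] : forall i, exists a, m i = shift a.
  by move=> k; apply: shiftP; rewrite leqNgt; apply/negP => km; apply: mK; exists k.
have := @pickle_invK (int * {ffun 'I_n -> int})%type i; rewrite jm /= => ij; move: Ni.
rewrite -ij (_ : (j, m) = tau (a, [ffun i => b i])).
  by apply/negP; rewrite -ltnNge ltnS; exact: leq_bigmax_cond.
by rewrite /tau ja; congr pair; apply/ffunP => k; rewrite !ffunE.
Qed.

(** * Cutting a function along growing sets *)

(** The pieces are [F] restricted to [K (N 0)] and to the differences
[K (N j.+1) `\` K (N j)], where [N j] is so large that the norm of [F] outside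
of [K (N j)] is at most [e / 2 ^ j.+1].  Each point lies in the piece given by the
first [j] such that it belongs to [K (N j)]. *)
Lemma Lnorm_cut d (T : measurableType d) (R : realType)
    (mu : {measure set T -> \bar R}) (r : R) (K : nat -> set T) (F : T -> R) (e : R) :
  (1 <= r)%R -> (0 < e)%R ->
  (forall N, measurable (K N)) -> nondecreasing_seq K -> \bigcup_N K N = setT ->
  measurable_fun setT F -> (forall x, 0 <= F x)%R ->
  Lnorm mu r%:E (EFin \o F) < +oo ->
  exists (N : nat -> nat) (u : nat -> T -> R),
    [/\ forall j, measurable_fun setT (u j), forall j x, (0 <= u j x)%R,
        forall j x, ~ K (N j) x -> u j x = 0%R,
        Lnorm mu r%:E (EFin \o u 0%N) <= Lnorm mu r%:E (EFin \o F) /\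
          forall j, Lnorm mu r%:E (EFin \o u j.+1) <= (e / (2 ^ j.+1)%:R)%:E &
        forall x, (F x)%:E <= \sum_(j <oo) (u j x)%:E].
Proof.
move=> r1 e0 mK ndK KT mF F0 Foo.
have r0 : (0 < r)%R by exact: lt_le_trans r1.
pose g x := `|(F x)%:E| `^ r.
have mg : measurable_fun setT g by apply: measurable_abse_poweR; exact/measurable_EFinP.
have g0 x : 0 <= g x by exact: poweR_ge0.
have goo : \int[mu]_x g x < +oo.
  by move: Foo; rewrite unlock => /lty_poweRy; rewrite invr_eq0 gt_eqF// => /(_ isT).
have eps0 j : (0 < (e / (2 ^ j.+1)%:R) `^ r)%R by rewrite powR_gt0// divr_gt0.
have /choice[N NP] : forall j, exists N, (j <= N)%N /\
    \int[mu]_(x in ~` K N) g x <= ((e / (2 ^ j.+1)%:R) `^ r)%:E.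
  move=> j; have [N jN NP] := integral_setC_small mK ndK KT mg g0 goo j (eps0 j).
  by exists N.
pose A j := if j is j'.+1 then K (N j) `\` K (N j') else K (N 0%N).
have mA j : measurable (A j) by case: j => //= j; exact: measurableD.
pose u j x := (F x * \1_(A j) x)%R.
have u0 j x : (0 <= u j x <= F x)%R.
  by rewrite /u indicE; case: (_ \in _); rewrite ?mulr1 ?mulr0 ?lexx F0.
have mu_ j : measurable_fun setT (u j).
  by apply: measurable_funM => //; exact: measurable_indic.
exists N, u; split => //.
- by move=> j x; case/andP: (u0 j x).
- move=> j x Kx; rewrite /u indicE memNset ?mulr0//.
  by case: j Kx => //= j Kx [].
- split; first exact: le_Lnorm_EFin.
  move=> j; have -> : (e / (2 ^ j.+1)%:R)%:E = ((e / (2 ^ j.+1)%:R) `^ r)%:E `^ r^-1.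
    by rewrite poweR_EFin -powRrM mulfV ?gt_eqF// powRr1// divr_ge0// ltW.
  rewrite unlock; apply: le_poweR; first by rewrite invr_ge0 ltW.
    by apply: integral_ge0 => x _; exact: poweR_ge0.
  apply: le_trans (NP j).2; rewrite [leRHS]integral_mkcond.
  apply: ge0_le_integral => //.
  + by move=> x _; exact: poweR_ge0.
  + by apply: measurable_abse_poweR; exact/measurable_EFinP.
  + apply/(measurable_restrictT _ (measurableC (mK _))); exact: measurable_funTS.
  move=> x _; rewrite patchE /u /= indicE; case: ifPn => [_|].
    rewrite lee_fin; apply: ge0_ler_powR; rewrite ?nnegrE//; first exact: ltW.
    by rewrite normrM ler_piMr//; case: (_ \in _); rewrite ?normr1 ?normr0.
  rewrite notin_setE => /contrapT Kx; rewrite memNset ?mulr0; last by case.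
  by rewrite normr0 powR0// gt_eqF.
- move=> x; have [j0 Kj0] : exists j, x \in K (N j).
    have [j _ Kj] : (\bigcup_N K N) x by rewrite KT.
    exists j; rewrite inE; have := ndK _ _ (NP j).1; rewrite subsetEset; exact.
  have [j Kj minj] := ex_minnP (ex_intro (fun j => x \in K (N j)) _ Kj0).
  have Aj : x \in A j.
    case: j Kj minj => // j Kj minj; rewrite inE; split; first by rewrite inE in Kj.
    by move=> Kjx; have := minj j; rewrite inE => /(_ Kjx); rewrite ltnn.
  have ge0 k : 0 <= (u k x)%:E by rewrite lee_fin; case/andP: (u0 k x).
  rewrite (nneseriesD1 (n := j))//; apply: le_trans (leeDl _ _).
    by rewrite /u indicE Aj mulr1.
  by apply: nneseries_ge0.
Qed.

(** * From the norm to dominations, and the case q < p *)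

Section extraction.
Context (R : realType) (n : nat).
Local Notation mu := (lebesgue_Rn R n).
Variables (p q : R).
Hypothesis q1 : (1 < q)%R.
Let r := conj_exp q.
Local Notation "'N_[ f ]" := (Lnorm mu r%:E f) (format "''N_[' f ]").

Lemma Lnorm_EFin_norm d (T : measurableType d) (nu : {measure set T -> \bar R})
    (c : R) (b : T -> R) : measurable_fun setT b ->
  Lnorm nu r%:E (EFin \o (fun x => `|c| * `|b x|)%R) = `|c|%:E * Lnorm nu r%:E (EFin \o b).
Proof.
move=> mb; rewrite -[in RHS]Lnorm_abse.
have r1 : (1 <= r)%R by exact/ltW/conj_exp_gt1.
by rewrite -(@LnormZ_ge0 _ _ _ nu r r1 `|c|%R (fun x => `|b x|%R))//; exact: measurableT_comp.
Qed.

Lemma series_of_block_norm (f : Rn R n -> \bar R) (s : R) :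
  block_norm p q f < s%:E ->
  exists (u : nat -> Rn R n -> R) (Q : nat -> set (Rn R n)) (lam : nat -> R),
    [/\ forall j, is_cube (Q j),
        forall j, measurable_fun setT (u j) /\ (forall x, 0 <= u j x)%R,
        forall j x, ~ Q j x -> u j x = 0%R,
        (forall j, (0 <= lam j)%R /\
          'N_[EFin \o u j] <= (lam j)%:E * mu (Q j) `^ (p^-1 - q^-1)) /\
          \sum_(j <oo) (lam j)%:E <= s%:E &
        {ae mu, forall x, f x <= \sum_(j <oo) (u j x)%:E}].
Proof.
move=> /ereal_inf_lt[_ [lambda [b [[lamoo bb bf] ->]]] lams].
have /choice[Q QP] := fun j => is_block_Lnorm q1 (bb j).
exists (fun j x => `|lambda j| * `|b j x|)%R, Q, (fun j => `|lambda j|%R); split.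
- by move=> j; case: (QP j).
- move=> j; split; last by move=> x; rewrite mulr_ge0.
  have [mb _] := bb j; apply: measurable_funM; first exact: measurable_cst.
  exact: measurableT_comp.
- by move=> j x Qx; case: (QP j) => _ -> //; rewrite normr0 mulr0.
- split; last exact: ltW.
  move=> j; split; first exact: normr_ge0.
  have [mb _] := bb j; have [_ _ bn] := QP j.
  rewrite Lnorm_EFin_norm//; apply: lee_wpmul2l => //.
- apply: filterS bf => x fx; apply: cvge_to_le fx _.
  apply: nearW => N; apply: (@le_trans _ _ (\sum_(0 <= j < N) (`|lambda j| * `|b j x|)%:E)).
    rewrite sumEFin lee_fin; apply: ler_sum => j _.
    by rewrite -normrM ler_norm.
  by apply: nneseries_lim_ge => j _ _; rewrite lee_fin mulr_ge0.
Qed.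

End extraction.

Lemma box_exhausts (R : realType) (n : nat) (x : Rn R n) :
  exists l : nat, box (fun=> - l%:R)%R (fun=> l%:R)%R x.
Proof.
exists (\max_(i < n) (Num.trunc `|Defs.coord x i|).+1)%N => i.
rewrite -ler_norml; apply/ltW; apply: lt_le_trans (truncnS_gt _) _.
by rewrite ler_nat;
  apply: (leq_bigmax_cond (F := fun i : 'I_n => (Num.trunc `|Defs.coord x i|).+1)).
Qed.

Section subcritical.
Context (R : realType) (n : nat).
Local Notation mu := (lebesgue_Rn R n).
Variables (p q s : R).
Hypothesis n0 : (0 < n)%N.
Hypothesis q1 : (1 < q)%R.
Hypothesis qp : (q < p)%R.
Hypothesis s1 : (1 < s)%R.
Let r := conj_exp q.
Let r1 : (1 <= r)%R. Proof. exact/ltW/conj_exp_gt1. Qed.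
Let theta : R := (q^-1 - p^-1)%R.
Local Notation "'N_[ f ]" := (Lnorm mu r%:E f) (format "''N_[' f ]").

Let theta_ge0 : (0 <= theta)%R.
Proof.
have q0 : (0 < q)%R by exact: lt_trans q1.
have p0 : (0 < p)%R by exact: lt_trans qp.
by apply/ltW; rewrite subr_gt0 ltf_pV2.
Qed.

Let theta_le1 : (theta <= 1)%R.
Proof.
have q0 : (0 < q)%R by exact: lt_trans q1.
have p0 : (0 < p)%R by exact: lt_trans qp.
rewrite lerBlDr; apply: (@le_trans _ _ 1%R); first by rewrite invf_le1// ltW.
by rewrite lerDl invr_ge0 ltW.
Qed.

Let index := (int * {ffun 'I_n -> int})%type.
Let cube i := grid_cube (R := R) s (odflt (0%R, [ffun=> 0%R]) (pickle_inv i : option index)).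
(* When i is not the code of a grid cube, G i is empty, which forces the i-th
   piece of a decomposition to vanish, but cube i is still some cube, on which
   this piece is a multiple of a block. *)
Let G i : set (Rn R n) := if (pickle_inv i : option index) is Some jm then cube i else set0.
Let w i : R := fine (mu (cube i) `^ theta).

Let cube_cube i : is_cube (cube i). Proof. exact: is_cube_grid. Qed.

Let w_cube i : (0 < w i)%R /\ mu (cube i) `^ theta = (w i)%:E /\
  (w i)%:E * mu (cube i) `^ (p^-1 - q^-1) = 1.
Proof.
have [v v0 vE] := cube_volume (cube_cube i); rewrite /w vE poweR_EFin.
split; first by rewrite /= powR_gt0.
split; first by [].
have -> : (p^-1 - q^-1 = - theta)%R by rewrite opprB.
by rewrite poweR_EFin -EFinM powRN mulfV// gt_eqF// powR_gt0.
Qed.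

Let G_cube i : G i `<=` cube i.
Proof. by rewrite /G; case: (pickle_inv i : option index) => [jm|] x. Qed.

(* Each cube of a given decomposition is replaced by a grid cube containing it;
   since theta <= 1 this costs at most a factor s ^ (2 n). *)
Let admissible_of_block_norm (f : Rn R n -> \bar R) : block_norm p q f < s%:E ->
  exists xi, admissible mu r G w (s ^+ (2 * n).+1) f xi.
Proof.
move=> /(series_of_block_norm q1)[u [Q [lam [cQ u0 uQ [ulam lams] fu]]]].
have /choice[jm jmP] := fun j => grid_cube_cover s1 (cQ j).
have Gjm j : G (pickle (jm j)) = grid_cube s (jm j).
  by rewrite /G /cube pickleK_inv.
have cubejm j : cube (pickle (jm j)) = grid_cube s (jm j).
  by rewrite /cube pickleK_inv.
apply: (@admissible_of_series _ _ _ mu r G w _ r1 _ f u (fun j => pickle (jm j))).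
- by move=> i; case: (w_cube i).
- by move=> j; case: (u0 j).
- by move=> j x; case: (u0 j).
- by move=> j x; rewrite Gjm => Gx; apply: uQ => /(jmP j).1.
- apply: (@le_trans _ _ (\sum_(j <oo) (s ^+ (2 * n))%:E * (lam j)%:E)).
    apply: lee_nneseries => [j _ _|j _].
      by rewrite mule_ge0 ?Lnorm_ge0// lee_fin ltW//; case: (w_cube (pickle (jm j))).
    have [lam0 uj] := ulam j.
    have [w0 [wE _]] := w_cube (pickle (jm j)).
    apply: le_trans (lee_wpmul2l _ uj) _; first by rewrite lee_fin ltW.
    rewrite muleCA [leRHS]muleC; apply: lee_wpmul2l; first by rewrite lee_fin.
    rewrite -wE cubejm; have [v v0 vE] := cube_volume (cQ j).
    have := (jmP j).2; have [v' v'0 v'E] := cube_volume (is_cube_grid (R := R) s (jm j)).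
    rewrite vE v'E -EFinM !poweR_EFin -EFinM !lee_fin => v'v.
    have -> : (p^-1 - q^-1 = - theta)%R by rewrite opprB.
    have sn1 : (1 <= s ^+ (2 * n))%R by rewrite exprn_ege1// ltW.
    have sn0 : (0 <= s ^+ (2 * n))%R by rewrite (le_trans _ sn1).
    rewrite powRN ler_pdivrMr ?powR_gt0//.
    apply: (@le_trans _ _ ((s ^+ (2 * n) * v) `^ theta)%R).
      by apply: ge0_ler_powR; rewrite ?nnegrE ?(ltW v'0) ?mulr_ge0 ?(ltW v0).
    rewrite powRM ?(ltW v0)//; apply: ler_wpM2r; first exact: powR_ge0.
    by rewrite -[leRHS]powRr1//; apply: ler_powR.
  rewrite nneseriesZl; last by move=> j _; rewrite lee_fin; case: (ulam j).
  rewrite exprSr EFinM; apply: lee_wpmul2l => //.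
  by rewrite lee_fin exprn_ge0// ltW// (lt_trans _ s1).
- exact: fu.
Qed.

Let tail (l : nat) (e : R) : (0 < e)%R -> exists N, forall i, (N <= i)%N ->
  forall u : Rn R n -> R, measurable_fun setT u -> (forall x, 0 <= u x)%R ->
    (forall x, ~ G i x -> u x = 0%R) ->
    \int[mu]_(x in box (fun=> - l%:R)%R (fun=> l%:R)%R) (u x)%:E <=
      e%:E * ((w i)%:E * 'N_[EFin \o u]).
Proof.
move=> e0; have [K KP] := grid_cube_tail_small s1 l n0 q1 qp e0.
have [N NP] := grid_index_bounded n K.
exists N => i Ni u mu_ u0 uG.
have [wi0 [wE _]] := w_cube i.
have mB : measurable (box (fun=> - l%:R)%R (fun=> l%:R)%R : set (Rn R n)).
  by apply: measurable_box => _; rewrite (@le_trans _ _ 0%R)// ?oppr_le0.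
have mG : measurable (G i).
  by rewrite /G; case: (pickle_inv i : option index) => [_|]//; exact: cube_measurable.
apply: le_trans (integral_le_Lnorm mu _ _ (conj_expVD q) mG mB mu_ u0 uG) _.
- exact: lt_le_trans r1.
- exact: lt_trans q1.
rewrite muleA [leRHS]muleC; apply: lee_wpmul2l; first exact: Lnorm_ge0.
rewrite -wE.
case ijm: (pickle_inv i : option index) (NP i Ni) => [jm|] NPi.
  have Gjm : G i = grid_cube s jm by rewrite /G /cube ijm.
  have Qjm : cube i = grid_cube s jm by rewrite /cube ijm.
  by rewrite Gjm Qjm; apply: KP; exact: NPi.
have -> : G i = set0 by rewrite /G ijm.
rewrite setI0 measure0 poweR0r; last by rewrite invr_eq0 gt_eqF// (lt_trans _ q1).
by rewrite mule_ge0 ?poweR_ge0// lee_fin ltW.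
Qed.

Lemma block_norm_lim_subcritical (f : Rn R n -> \bar R) (f_ : nat -> Rn R n -> \bar R) :
  measurable_fun setT f -> {ae mu, forall x, 0 <= f x} ->
  (forall k, block_norm p q (f_ k) < s%:E) ->
  {ae mu, forall x, nondecreasing_seq (f_ ^~ x) /\ f_ k x @[k --> \oo] --> f x} ->
  block_norm p q f <= (s ^+ (2 * n).+1)%:E.
Proof.
move=> mf f0 fs ff.
have w0 i : (0 < w i)%R by case: (w_cube i).
have mG i : measurable (G i).
  by rewrite /G; case: (pickle_inv i : option index) => [_|]//; exact: cube_measurable.
have finG i : mu (G i) < +oo.
  rewrite /G; case: (pickle_inv i : option index) => [_|]; last by rewrite measure0.
  by have [v _ ->] := cube_volume (cube_cube i); rewrite ltry.
have [xi xiP] : exists xi, forall k, admissible mu r G w (s ^+ (2 * n).+1) (f_ k) xi.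
  apply: (@admissible_lim _ _ _ mu r G w _ r1 w0 mG finG f_
    (fun l => box (fun=> - l%:R)%R (fun=> l%:R)%R) _ _ _ _ tail).
  - by apply: filterS ff => x [].
  - by move=> k; exact: admissible_of_block_norm.
  - by move=> l; apply: measurable_box => _; rewrite (@le_trans _ _ 0%R)// ?oppr_le0.
  - exact: box_exhausts.
have [mxi xi0 xiG xiC _] := xiP 0%N.
have wN0 i : 0 <= (w i)%:E * 'N_[EFin \o xi i] by rewrite mule_ge0 ?Lnorm_ge0// lee_fin ltW.
have wNfin i : (w i)%:E * 'N_[EFin \o xi i] \is a fin_num.
  rewrite ge0_fin_numE//; apply: le_lt_trans (ltry (s ^+ (2 * n).+1)).
  apply: le_trans xiC; rewrite (nneseriesD1 (n := i))//.
  by apply: leeDl; apply: nneseries_ge0.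
have := @block_norm_le R n p q q1 f xi cube
  (fun i => fine ((w i)%:E * 'N_[EFin \o xi i])) mf f0 cube_cube mxi xi0.
move=> /(_ (fun i x cx => xiG i x (fun Gx => cx (G_cube Gx)))) H.
apply: le_trans (H _ _ _) _.
- by move=> i; exact: fine_ge0.
- move=> i; have [_ [_ wQ]] := w_cube i; rewrite fineK//.
  by rewrite muleAC wQ mul1e.
- have xif : {ae mu, forall x, forall k, f_ k x <= \sum_(i <oo) (xi i x)%:E}.
    by apply: ae_foralln => k; case: (xiP k).
  apply: filterS2 ff xif => x [_ fx] xix; apply: cvge_to_le fx _; exact: nearW.
- by under eq_eseriesr do rewrite fineK//.
Qed.

End subcritical.

(** * The case q = p *)

(** If [q = p], blocks are just functions of [L^q'] norm at most [1] with support
in a cube and the block space is [L^q']; there is no decay for large cubes and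
the compactness argument breaks down, but Fatou's lemma in [L^q'] suffices. *)
Section critical.
Context (R : realType) (n : nat).
Local Notation mu := (lebesgue_Rn R n).
Variables (q : R).
Hypothesis q1 : (1 < q)%R.
Let r := conj_exp q.
Let r1 : (1 <= r)%R. Proof. exact/ltW/conj_exp_gt1. Qed.
Local Notation "'N_[ f ]" := (Lnorm mu r%:E f) (format "''N_[' f ]").

Lemma Lnorm_le_of_block_norm (f : Rn R n -> \bar R) (s : R) :
  measurable_fun setT f -> {ae mu, forall x, 0 <= f x} ->
  block_norm q q f < s%:E -> 'N_[f] <= s%:E.
Proof.
move=> mf f0 /(series_of_block_norm q1)[u [Q [lam [cQ u0 uQ [ulam lams] fu]]]].
apply: (@le_trans _ _ ('N_[fun x => \sum_(j <oo) (u j x)%:E])).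
  apply: le_Lnorm; [exact: r1|exact: mf| |].
    apply: measurable_nneseries => [j x _|j]; first by rewrite lee_fin; case: (u0 j).
    by apply/measurable_EFinP; case: (u0 j).
  apply: filterS2 f0 fu => x f0 fu; rewrite gee0_abs//; apply: le_trans fu _.
  exact: lee_abs.
apply: le_trans (Lnorm_nneseries mu r1 _ _) _.
- by move=> j; case: (u0 j).
- by move=> j x; case: (u0 j).
apply: le_trans lams; apply: lee_nneseries => [j _ _|j _]; first exact: Lnorm_ge0.
by have [_] := ulam j; rewrite subrr poweRe0 mule1.
Qed.

Lemma block_norm_le_Lnorm (f : Rn R n -> \bar R) (F : Rn R n -> R) (c e : R) :
  measurable_fun setT f -> {ae mu, forall x, 0 <= f x} ->
  measurable_fun setT F -> (forall x, 0 <= F x)%R -> (0 < e)%R ->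
  'N_[EFin \o F] <= c%:E -> {ae mu, forall x, f x <= (F x)%:E} ->
  block_norm q q f <= (c + e)%:E.
Proof.
move=> mf f0 mF F0 e0 Fc fF.
have c0 : (0 <= c)%R by rewrite -lee_fin; apply: le_trans Fc; exact: Lnorm_ge0.
pose K N : set (Rn R n) := box (fun=> - N.+1%:R)%R (fun=> N.+1%:R)%R.
have NN (N : nat) : (- N.+1%:R <= N.+1%:R :> R)%R by rewrite (@le_trans _ _ 0%R)// ?oppr_le0.
have mK N : measurable (K N) by apply: measurable_box.
have cK N : is_cube (K N).
  exists (fun=> - N.+1%:R)%R, (N.+1%:R + N.+1%:R)%R; split; first exact: addr_gt0.
  by congr box; apply/funext => i; rewrite addKr.
have ndK : nondecreasing_seq K.
  move=> N M NM; apply/subsetPset => x xK i; have /andP[xi ix] := xK i.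
  have NM' : (N.+1%:R <= M.+1%:R :> R)%R by rewrite ler_nat.
  by rewrite (le_trans ix NM') (le_trans _ xi)// lerN2.
have KT : \bigcup_N K N = setT.
  apply/seteqP; split => // x _; have [l xl] := box_exhausts x.
  exists l => // i; have /andP[xi ix] := xl i.
  have ll : (l%:R <= l.+1%:R :> R)%R by rewrite ler_nat.
  by rewrite (le_trans ix ll) (le_trans _ xi)// lerN2.
have [N [u [mu_ u0 uK [uN0 uN] Fu]]] :=
  Lnorm_cut r1 e0 mK ndK KT mF F0 (le_lt_trans Fc (ltry c)).
pose lam j : R := if j is j'.+1 then (e / (2 ^ j'.+1)%:R)%R else c.
have lam0 j : (0 <= lam j)%R by case: j => //= j; rewrite divr_ge0// ltW.
apply: le_trans (_ : _ <= \sum_(j <oo) (lam j)%:E) _.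
  apply: (@block_norm_le R n q q q1 f u (fun j => K (N j)) lam mf f0 _ mu_ u0 uK lam0).
  - by move=> j; exact: cK.
  - move=> j; rewrite subrr poweRe0 mule1; case: j => [|j]; first exact: le_trans Fc.
    exact: uN.
  - by apply: filterS fF => x; move=> /le_trans; apply; exact: Fu.
rewrite nneseries_recl//; last by move=> j _; rewrite lee_fin.
rewrite EFinD leeD2l// -(nneseries_addn 1); last by move=> j; rewrite lee_fin.
under eq_eseriesr do rewrite addn1.
exact: (epsilon_trick0 xpredT (ltW e0)).
Qed.

Lemma block_norm_lim_critical (f : Rn R n -> \bar R) (f_ : nat -> Rn R n -> \bar R)
  (s e : R) : (0 < e)%R ->
  measurable_fun setT f -> {ae mu, forall x, 0 <= f x} ->
  (forall k, measurable_fun setT (f_ k)) ->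
  (forall k, {ae mu, forall x, 0 <= f_ k x}) ->
  (forall k, block_norm q q (f_ k) < s%:E) ->
  {ae mu, forall x, f_ k x @[k --> \oo] --> f x} ->
  block_norm q q f <= (s + e)%:E.
Proof.
move=> e0 mf f0 mf_ f_0 fs ff.
pose h x := limn_einf (fun k => `|f_ k x|).
have mh : measurable_fun setT h.
  apply: (measurable_limn_einf (f := fun k x => `|f_ k x|)) => k.
  exact: measurableT_comp.
have hs : 'N_[h] <= s%:E.
  apply: le_trans (Lnorm_fatou mu r1 (u := fun k x => `|f_ k x|) _ _) _.
  - by move=> k; exact: measurableT_comp.
  - by move=> k x; exact: abse_ge0.
  - apply: limn_einf_le_ub => k; rewrite -/(abse \o f_ k) Lnorm_abse.
    exact: Lnorm_le_of_block_norm.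
have h0 x : 0 <= h x by apply: limn_einf_ge0 => k; exact: abse_ge0.
have hfin : {ae mu, forall x, h x \is a fin_num}.
  by apply: (Lnorm_lty_ae r1 mh); exact: le_lt_trans hs (ltry s).
apply: (@block_norm_le_Lnorm f (fun x => fine (h x)) s e mf f0 _ _ e0).
- exact: (measurableT_comp (@fine_measurable R setT measurableT) mh).
- by move=> x; exact: fine_ge0.
- apply: le_trans hs; apply: le_Lnorm; [exact: r1| |exact: mh|].
    apply/measurable_EFinP.
    exact: (measurableT_comp (@fine_measurable R setT measurableT) mh).
  by apply: aeW => x /=; case: (h x) => [a| |]//=; rewrite ?normr0 ?leey.
- apply: filterS2 hfin (filterI ff (ae_foralln f_0)) => x hx [fx fx0].
  rewrite fineK// /h (_ : (fun k => `|f_ k x|) = f_ ^~ x).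
    by rewrite (cvg_limn_einfE fx).
  by apply/funext => k; rewrite gee0_abs.
Qed.

End critical.

(** * The Fatou property *)

(** The Lebesgue measure is complete, so changing a measurable function on a
negligible set preserves measurability. *)
Lemma measurable_ae_lim (R : realType) (n : nat) (f : Rn R n -> \bar R)
    (f_ : nat -> Rn R n -> \bar R) :
  (forall k, measurable_fun setT (f_ k)) ->
  {ae lebesgue_Rn R n, forall x, f_ k x @[k --> \oo] --> f x} ->
  measurable_fun setT f.
Proof.
move=> mf ff.
apply: (ae_measurable_fun (mu := lebesgue_Rn R n) _
  (f := fun x => limn_einf (f_ ^~ x))).
- exact: measure_is_complete_caratheodory.
- by apply: filterS ff => x fx _; exact: cvg_limn_einfE.
- exact: (measurable_limn_einf (f := f_)).
Qed.

Unset Implicit Arguments.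

Theorem theorem1p2 (R : realType) (n : nat) (hn : (0 < n)%N)
  (p q : R) (hq : (1 < q)%R) (hqp : (q <= p)%R)
  (f : Rn R n -> \bar R) (f_ : nat -> Rn R n -> \bar R)
  (hf0 : {ae lebesgue_Rn R n, forall x, 0 <= f x})
  (hfk0 : forall k, {ae lebesgue_Rn R n, forall x, 0 <= f_ k x})
  (hfkB : forall k, block_space p q (f_ k))
  (hfk1 : forall k, block_norm p q (f_ k) <= 1)
  (hfk : {ae lebesgue_Rn R n, forall x,
     nondecreasing_seq (f_ ^~ x) /\ f_ k x @[k --> \oo] --> f x}) :
  block_space p q f /\ block_norm p q f <= 1.
Proof.
have mf_ k : measurable_fun setT (f_ k) by case: (hfkB k).
have ff : {ae lebesgue_Rn R n, forall x, f_ k x @[k --> \oo] --> f x}.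
  by apply: filterS hfk => x [].
have mf : measurable_fun setT f := measurable_ae_lim mf_ ff.
suff f1 : block_norm p q f <= 1.
  by split => //; split => //; exact: le_lt_trans f1 (ltry 1%R).
have lts (s : R) : (1 < s)%R -> forall k, block_norm p q (f_ k) < s%:E.
  by move=> s1 k; apply: le_lt_trans (hfk1 k) _; rewrite lte_fin.
apply/lee_addgt0Pr => e e0; rewrite -EFinD.
move: hqp; rewrite le_eqVlt => /predU1P[qp|qp].
  rewrite -{}qp in lts *.
  have e20 : (0 < e / 2)%R by rewrite divr_gt0.
  have -> : (1 + e = (1 + e / 2) + e / 2)%R by field.
  by apply: (block_norm_lim_critical hq e20 mf hf0 mf_ hfk0 _ ff); apply: lts; rewrite ltrDl.
pose s := ((1 + e) `^ ((2 * n).+1%:R^-1))%R.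
have e1 : (1 < 1 + e)%R by rewrite ltrDl.
have s1 : (1 < s)%R.
  rewrite /s /powR gt_eqF ?(lt_trans _ e1)// -[ltLHS]expR0 ltr_expR.
  by rewrite mulr_gt0 ?invr_gt0 ?ltr0n ?ln_gt0.
have -> : (1 + e = s ^+ (2 * n).+1)%R.
  by rewrite -powR_mulrn ?powR_ge0// /s -powRrM mulVf// powRr1// ltW// (lt_trans _ e1).
exact: (block_norm_lim_subcritical hn hq qp s1 mf hf0 (lts s s1) hfk).
Qed.
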